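(* Let $\mathcal{X}=\mathbb{R}^d$ and let $\mu,\nu$ be probability measures on $\mathcal{X}$ with $\mu\ll\nu$. Suppose there exists a compact set $K\subset\mathcal{X}$ such that the model is $K$ locally predictable and $K$ locally observable. Then the one step predictors $\pi_{n-}^{\mu}$ and $\pi_{n-}^{\nu}$ merge weakly $P^{\mu}$-almost surely, i.e. $P^\mu$-a.s., for every $f\in C_b(\mathcal{X})$, $\lim_{n\to\infty}\left|\int f\,d\pi_{n-}^{\mu}-\int f\,d\pi_{n-}^{\nu}\right|=0$.
   Context: Setting: $\mathcal{Y},\mathcal{Z}$ are Polish spaces, $\mathcal{X}=\mathbb{R}^d$. $T$ is a transition kernel on $\mathcal{X}$; $\{Z_n\}$ is i.i.d. with law $Q$ on $\mathcal{Z}$, independent of the states; $h:\mathcal{X}\times\mathcal{Z}\to\mathcal{Y}$ measurable. $\{X_n\}$ is a Markov chain with kernel $T$ and $X_0\sim\mu$, and $Y_n=h(X_n,Z_n)$. $P^\mu$ is the joint law of $\{(X_n,Y_n)\}$ when $X_0\sim\mu$. The one step predictor is $\pi_{n-}^{\mu}(\cdot)=P^{\mu}(X_n\in\cdot\mid Y_0,\dots,Y_{n-1})$. $K$ locally predictable: there exist measurable maps $a_n:\mathcal{Y}^n\to\mathcal{X}$ (so $a_n=a_n(Y_0,\dots,Y_{n-1})$) such that $\pi_{n-}^{\nu'}(K+a_n)=1$ $P^\mu$-a.s. for every prior $\nu'$ with $\mu\ll\nu'$ (in particular for $\nu'=\mu$ and $\nu'=\nu$) and every $n$. $K$ locally observable: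 for every $f\in C_b(\mathcal{X})$, every sequence $(a_n)$ in $\mathcal{X}$ and every $\epsilon>0$, there exist measurable functions $g_n:\mathcal{Y}\to\mathbb{R}$, uniformly bounded in $n$, such that $\sup_{x\in K+a_n}\left|f(x)-\int_{\mathcal{Z}}g_n(h(x,z))Q(dz)\right|\le\epsilon$ for every $n\in\mathbb{N}$. *)

(* Defs.v *)
From HB Require Import structures.
From mathcomp Require Import all_boot all_order all_algebra.
From mathcomp Require Import all_classical all_reals all_analysis.

Set Implicit Arguments.
Unset Strict Implicit.
Unset Printing Implicit Defensive.

Import Order.TTheory GRing.Theory Num.Theory.
Import numFieldNormedType.Exports.

Local Open Scope classical_set_scope.
Local Open Scope ring_scope.

Definition Borel (T : topologicalType) := g_sigma_algebraType (@open T).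

Definition Xsp (R : realType) (d : nat) := Borel 'rV[R]_d.

(* Polish space: a separable, completely metrizable topological space;
   we take the complete metric as given (a complete pseudometric whose
   topology is Hausdorff), plus a countable dense subset. *)
Definition polish (R : realType) (T : completePseudoMetricType R) : Prop :=
  hausdorff_space T /\ exists D : set T, countable D /\ dense D.

Definition path_gen (dY : measure_display) (Y : measurableType dY)
  : set (set (nat -> Y)) :=
  \bigcup_(i in [set: nat]) [set (fun y : nat -> Y => y i) @^-1` B | B in measurable].

Definition Path (dY : measure_display) (Y : measurableType dY) :=
  g_sigma_algebraType (@path_gen dY Y).

Definition depends_on_first (A B : Type) (n : nat) (F : (nat -> A) -> B) : Prop :=
  forall y y' : nat -> A, (forall i, (i < n)%N -> y i = y' i) -> F y = F y'.

Definition sigma_gen (dO : measure_display) (O : measurableType dO) (I : Type)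
  (J : set I) (dT : measure_display) (T : measurableType dT) (V : I -> O -> T)
  : set (set O) :=
  <<s \bigcup_(i in J) [set V i @^-1` A | A in measurable] >>.

Definition abs_cont (R : realType) (dX : measure_display) (X : measurableType dX)
  (mu nu : probability X R) : Prop :=
  forall A, measurable A -> nu A = 0%E -> mu A = 0%E.

Definition obs (dX dY dZ : measure_display) (X : measurableType dX)
  (Y : measurableType dY) (Z : measurableType dZ) (O : Type)
  (h : X -> Z -> Y) (Xs : nat -> O -> X) (Zs : nat -> O -> Z) (w : O) : nat -> Y :=
  fun i => h (Xs i w) (Zs i w).

(* (Omega, P, X, Z) realizes the model with initial law rho:
   X is a Markov chain with kernel T and X_0 ~ rho, and
   (Z_n) is i.i.d. with law Q and independent of (X_n)
   (stated through all finite-dimensional rectangles). *)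
Definition hmm_realization (R : realType) (dX dZ : measure_display)
  (X : measurableType dX) (Z : measurableType dZ)
  (T : R.-pker X ~> X) (Q : probability Z R) (rho : probability X R)
  (dO : measure_display) (O : measurableType dO) (P : probability O R)
  (Xs : nat -> O -> X) (Zs : nat -> O -> Z) : Prop :=
  [/\ (forall n, measurable_fun setT (Xs n)),
      (forall n, measurable_fun setT (Zs n)),
      (forall A, measurable A -> P (Xs 0%N @^-1` A) = rho A),
      (forall n A E, measurable A -> sigma_gen `I_n.+1 Xs E ->
          P (Xs n.+1 @^-1` A `&` E) = (\int[P]_(w in E) T (Xs n w) A)%E) &
      (forall n (A : nat -> set X) (C : nat -> set Z),
          (forall i, measurable (A i)) -> (forall i, measurable (C i)) ->
          P (\bigcap_(i in `I_n) (Xs i @^-1` A i `&` Zs i @^-1` C i)) =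
          (P (\bigcap_(i in `I_n) Xs i @^-1` A i) * \prod_(i < n) Q (C i))%E)].

(* Phi is a version of the one step predictor
     pi_{n-}^rho = P^rho(X_n in . | Y_0, ..., Y_{n-1}),
   written as a probability kernel from the observation sequences
   (depending only on y_0..y_{n-1}) to X.  The defining property of a
   regular conditional distribution is required on every realization
   of the model with initial law rho (it only depends on the law). *)
Definition is_predictor (R : realType) (dX dY dZ : measure_display)
  (X : measurableType dX) (Y : measurableType dY) (Z : measurableType dZ)
  (T : R.-pker X ~> X) (Q : probability Z R) (h : X -> Z -> Y)
  (rho : probability X R) (Phi : nat -> R.-pker (Path Y) ~> X) : Prop :=
  (forall n, depends_on_first n (Phi n)) /\
  forall (dO : measure_display) (O : measurableType dO) (P : probability O R)
    (Xs : nat -> O -> X) (Zs : nat -> O -> Z),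
    hmm_realization T Q rho P Xs Zs ->
    forall n A E, measurable A ->
      sigma_gen `I_n (fun i w => h (Xs i w) (Zs i w)) E ->
      P (Xs n @^-1` A `&` E) =
      (\int[P]_(w in E) Phi n (obs h Xs Zs w : Path Y) A)%E.

Definition translate (R : realType) (d : nat) (K : set 'rV[R]_d) (a : 'rV[R]_d)
  : set 'rV[R]_d := [set x + a | x in K].

(* K locally predictable, P^mu-a.s. being expressed on the realization
   (Omega, P, Xs, Zs) of the model started at mu. *)
Definition locally_predictable (R : realType) (d : nat) (dY dZ : measure_display)
  (Y : measurableType dY) (Z : measurableType dZ)
  (T : R.-pker Xsp R d ~> Xsp R d) (Q : probability Z R) (h : Xsp R d -> Z -> Y)
  (mu : probability (Xsp R d) R)
  (dO : measure_display) (O : measurableType dO) (P : probability O R)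
  (Xs : nat -> O -> Xsp R d) (Zs : nat -> O -> Z) (K : set 'rV[R]_d) : Prop :=
  exists a : nat -> Path Y -> Xsp R d,
    (forall n, measurable_fun setT (a n)) /\
    (forall n, depends_on_first n (a n)) /\
    forall (nu' : probability (Xsp R d) R) (Phi' : nat -> R.-pker (Path Y) ~> Xsp R d),
      abs_cont mu nu' -> is_predictor T Q h nu' Phi' ->
      forall n, {ae P, forall w,
        Phi' n (obs h Xs Zs w : Path Y)
          (translate K (a n (obs h Xs Zs w : Path Y))) = 1%E}.

Definition locally_observable (R : realType) (d : nat) (dY dZ : measure_display)
  (Y : measurableType dY) (Z : measurableType dZ)
  (Q : probability Z R) (h : Xsp R d -> Z -> Y) (K : set 'rV[R]_d) : Prop :=
  forall f : 'rV[R]_d -> R, continuous f -> (exists M : R, forall x, `|f x| <= M) ->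
  forall (a : nat -> 'rV[R]_d) (eps : R), 0 < eps ->
  exists g : nat -> Y -> R,
    (forall n, measurable_fun setT (g n)) /\
    (exists M : R, forall n y, `|g n y| <= M) /\
    forall n x, translate K (a n) x ->
      `|f x - Rintegral Q setT (fun z => g n (h x z))| <= eps.

(* Main.v *)
(** The predictors of the next state determine the conditional laws [p_n] and
    [q_n] of [Y_n] given [Y_0, ..., Y_(n-1)] under [P^mu] and [P^nu].  It is
    enough that [p_n] and [q_n] merge in total variation [P^mu]-almost surely:
    on a fixed path, local observability along [a_n] approximates a test
    function [f], up to [eps] on [K + a_n], by [x |-> \int g_n(h(x,z)) Q(dz)],
    whose predicted mean is [\int g_n dp_n] (resp. [\int g_n dq_n]), and the
    random choice of [g_n] is harmless because total variation is uniform in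
    bounded test functions.

    Merging: let [M], [N] be the laws of the observations started from [mu] and
    [nu], and [D_n] the density of [M] with respect to [M + N] on the
    sigma-algebra of the first [n] coordinates, a martingale with values in
    [0, 1].  If [S_n] is an event of the first [n.+1] coordinates, then
    [A_n = D_n (1 - D_n) (p_n(S_n) - q_n(S_n))] is the conditional expectation
    of [(D_(n+1) - D_n) 1_(S_n)], so [E A_n^2 <= E (D_(n+1) - D_n)^2], which
    is summable, and [A_n] tends to [0] almost surely.  The maximal inequality
    bounds [D_n] (resp. [1 - D_n]) away from [0] [M]-a.s. (resp. [N]-a.s.), and
    [M << N].  Choosing [S_n] as the first set of a countable generating algebra
    on which the laws differ by more than [eps] gives total variation.

    A realization started from [nu], without which the predictor of [nu] is
    unconstrained, is built with the Ionescu-Tulcea theorem. *)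
Require Import Defs.
From HB Require Import structures.
From mathcomp Require Import all_boot all_order all_algebra.
From mathcomp Require Import all_classical all_reals all_analysis.
From mathcomp Require Import measurable_realfun.
From mathcomp Require Import ring lra.

Import Order.TTheory GRing.Theory Num.Theory.
Import numFieldNormedType.Exports.

Set Implicit Arguments.
Unset Strict Implicit.
Unset Printing Implicit Defensive.

Local Open Scope classical_set_scope.
Local Open Scope ring_scope.

(** * Image measures *)

Section image_law.
Local Open Scope ereal_scope.
Context d1 d2 (T1 : measurableType d1) (T2 : measurableType d2) (R : realType).

(** The measurability proof is an argument, so that the measure and probability structures attach to
    the term itself. *)
Definition image_law (m : {measure set T1 -> \bar R}) (f : T1 -> T2)
  (mf : measurable_fun setT f) (A : set T2) : \bar R := m (f @^-1` A).

Section measure.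
Variables (m : {measure set T1 -> \bar R}) (f : T1 -> T2).
Hypothesis mf : measurable_fun setT f.

Let image_law0 : image_law m mf set0 = 0.
Proof. by rewrite /image_law preimage_set0 measure0. Qed.

Let image_law_ge0 A : 0 <= image_law m mf A.
Proof. exact: measure_ge0. Qed.

Let image_law_sigma_additive : semi_sigma_additive (image_law m mf).
Proof.
move=> F mF tF mUF; rewrite /image_law preimage_bigcup.
apply: measure_semi_sigma_additive.
- by move=> n; rewrite -[X in measurable X]setTI; exact: mf.
- apply/trivIsetP => /= i j _ _ ij; rewrite -preimage_setI.
  by move/trivIsetP : tF => /(_ _ _ _ _ ij) ->//; rewrite preimage_set0.
- by rewrite -preimage_bigcup -[X in measurable X]setTI; exact: mf.
Qed.

HB.instance Definition _ := isMeasure.Build _ _ _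
  (image_law m mf) image_law0 image_law_ge0 image_law_sigma_additive.

End measure.

Section probability.
Variables (m : probability T1 R) (f : T1 -> T2).
Hypothesis mf : measurable_fun setT f.

Let image_law_setT : image_law m mf setT = 1.
Proof. by rewrite /image_law preimage_setT; exact: probability_setT. Qed.

HB.instance Definition _ := Measure_isProbability.Build _ _ _
  (image_law m mf) image_law_setT.

End probability.

Lemma ge0_integral_image_law (m : {measure set T1 -> \bar R}) (f : T1 -> T2)
    (mf : measurable_fun setT f) D (g : T2 -> \bar R) : measurable D ->
  measurable_fun D g -> {in D, forall y, 0 <= g y} ->
  \int[image_law m mf]_(y in D) g y = \int[m]_(x in f @^-1` D) g (f x).
Proof. exact: ge0_integral_pushforward. Qed.

End image_law.

(** * Reparametrization and composition of probability kernels *)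

Section kernel_operations.
Local Open Scope ereal_scope.
Context d0 d1 d2 (S : measurableType d0) (X : measurableType d1)
  (Y : measurableType d2) (R : realType).

Definition kmap (f : S -> X) (mf : measurable_fun setT f) (k : R.-pker X ~> Y)
  (s : S) : {measure set Y -> \bar R} := k (f s).

Section kmap.
Variables (f : S -> X) (mf : measurable_fun setT f) (k : R.-pker X ~> Y).

Let measurable_kmap U : measurable U ->
  measurable_fun [set: S] (kmap mf k ^~ U).
Proof.
by move=> mU; apply: (measurableT_comp (measurable_kernel k U mU)).
Qed.

HB.instance Definition _ := isKernel.Build _ _ _ _ _ (kmap mf k) measurable_kmap.

Let kmap_prob s : kmap mf k s setT = 1.
Proof. by rewrite /kmap prob_kernel. Qed.

HB.instance Definition _ :=
  Kernel_isProbability.Build _ _ _ _ _ (kmap mf k) kmap_prob.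
End kmap.

Definition kbind (l : R.-pker S ~> X) (k : R.-pker S * X ~> Y)
  (s : S) : {measure set Y -> \bar R} := (l \; k) s.

Section kbind.
Variables (l : R.-pker S ~> X) (k : R.-pker S * X ~> Y).

Let measurable_kbind U : measurable U ->
  measurable_fun [set: S] (kbind l k ^~ U).
Proof. by move=> mU; exact: measurable_fun_mkcomp_sfinite. Qed.

HB.instance Definition _ := isKernel.Build _ _ _ _ _ (kbind l k) measurable_kbind.

Let kbind_prob s : kbind l k s setT = 1.
Proof.
rewrite /kbind/= /kcomp/=; under eq_integral do rewrite prob_kernel.
by rewrite integral_cst// prob_kernel mule1.
Qed.

HB.instance Definition _ :=
  Kernel_isProbability.Build _ _ _ _ _ (kbind l k) kbind_prob.
End kbind.

End kernel_operations.

(** * Path space and events of finitely many coordinates *)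

Section paths.
Context dY (Y : measurableType dY).

Lemma measurable_coord (i : nat) :
  measurable_fun setT (fun y : Path Y => y i).
Proof.
move=> _ B mB; rewrite setTI; apply: sub_sigma_algebra.
by exists i => //; exists B.
Qed.

Lemma measurable_to_path d (T : measurableType d) (f : T -> Path Y) :
  (forall i, measurable_fun setT (fun t => f t i)) -> measurable_fun setT f.
Proof.
move=> mf; apply: (@measurability _ _ _ (Path Y) _ _ (@path_gen dY Y)) => //.
move=> _ [_ [i _ [B mB <-]] <-].
by rewrite -comp_preimage; exact: mf.
Qed.

Definition upd (y : Path Y) (n : nat) (x : Y) : Path Y :=
  fun i => if i == n then x else y i.

Lemma measurable_upd n : measurable_fun setT (fun p : Path Y * Y => upd p.1 n p.2).
Proof.
apply: measurable_to_path => i; rewrite /upd; case: eqP => _.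
  exact: measurable_snd.
exact: (measurableT_comp (measurable_coord i) measurable_fst).
Qed.

(** Forgets the coordinates from [n] on by setting them to [point]. A map that depends on the first
    [n] coordinates is unchanged by composition with [trunc n], so image measures under [trunc n]
    replace restrictions to a sub-sigma-algebra. *)
Definition trunc (n : nat) (y : Path Y) : Path Y :=
  fun i => if (i < n)%N then y i else point.

Lemma measurable_trunc n : measurable_fun setT (trunc n).
Proof.
apply: measurable_to_path => i; rewrite /trunc; case: (i < n)%N => //.
exact: measurable_coord.
Qed.

Lemma depends_trunc A n (F : Path Y -> A) y :
  depends_on_first n F -> F (trunc n y) = F y.
Proof. by apply=> i ni; rewrite /trunc ni. Qed.

Lemma depends_on_first_trunc A n (F : Path Y -> A) :
  depends_on_first n (F \o trunc n).
Proof.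
by move=> y y' yy'; congr F; apply/funext => i; rewrite /trunc; case: ifP => // /yy'.
Qed.

Lemma depends_on_firstW A n m (F : Path Y -> A) :
  (n <= m)%N -> depends_on_first n F -> depends_on_first m F.
Proof. by move=> nm dF y y' yy'; apply: dF => i ni; apply: yy'; exact: leq_trans nm. Qed.

Definition cylinder (n : nat) (A : set (Path Y)) :=
  measurable A /\ depends_on_first n A.

Lemma cylinderW n m A : (n <= m)%N -> cylinder n A -> cylinder m A.
Proof. by move=> nm [mA dA]; split => //; exact: depends_on_firstW dA. Qed.

Lemma cylinder0 n : cylinder n set0.
Proof. by split. Qed.

Lemma cylinderU n A B : cylinder n A -> cylinder n B -> cylinder n (A `|` B).
Proof.
move=> [mA dA] [mB dB]; split; first exact: measurableU.
by move=> y y' yy'; rewrite /setU /mkset (dA _ _ yy') (dB _ _ yy').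
Qed.

Lemma cylinderI n A B : cylinder n A -> cylinder n B -> cylinder n (A `&` B).
Proof.
move=> [mA dA] [mB dB]; split; first exact: measurableI.
by move=> y y' yy'; rewrite /setI /mkset (dA _ _ yy') (dB _ _ yy').
Qed.

Lemma cylinderC n A : cylinder n A -> cylinder n (~` A).
Proof.
move=> [mA dA]; split; first exact: measurableC.
by move=> y y' yy'; rewrite /setC /mkset (dA _ _ yy').
Qed.

Lemma cylinder_coord n (B : set Y) :
  measurable B -> cylinder n.+1 ((fun y : Path Y => y n) @^-1` B).
Proof.
move=> mB; split; first by rewrite -[X in measurable X]setTI; exact: measurable_coord.
by move=> y y' yy'; rewrite /preimage /mkset yy'.
Qed.

Lemma cylinder_trunc n (A : set (Path Y)) :
  measurable A -> cylinder n (trunc n @^-1` A).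
Proof.
move=> mA; split; first by rewrite -[X in measurable X]setTI; exact: measurable_trunc.
exact: (depends_on_first_trunc A).
Qed.

Lemma trunc_cylinder n (A : set (Path Y)) : depends_on_first n A ->
  trunc n @^-1` A = A.
Proof. by move=> dA; apply/funext => y; exact: depends_trunc. Qed.

Definition cyl : set (set (Path Y)) := [set A | exists n, cylinder n A].

End paths.

Definition cyl_display : measure_display. Proof. exact. Qed.

(** A copy of the path space whose measurable sets are only the cylinders: an algebra, on which the
    content is defined before its extension. *)
Definition CylPath dY (Y : measurableType dY) := Path Y.
HB.instance Definition _ dY (Y : measurableType dY) := Pointed.on (CylPath Y).

Section cylinder_algebra.
Context dY (Y : measurableType dY).

Let cyl0 : @cyl _ Y set0. Proof. by exists 0%N; exact: cylinder0. Qed.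

Let cylU : setU_closed (@cyl _ Y).
Proof.
move=> A B [n cA] [m cB]; exists (maxn n m); apply: cylinderU.
  by apply: cylinderW cA; rewrite leq_maxl.
by apply: cylinderW cB; rewrite leq_maxr.
Qed.

Let cylC : setC_closed (@cyl _ Y).
Proof. by move=> A [n cA]; exists n; exact: cylinderC. Qed.

HB.instance Definition _ := @isAlgebraOfSets.Build cyl_display (CylPath Y)
  (@cyl _ Y) cyl0 cylU cylC.

End cylinder_algebra.

(** * Ionescu-Tulcea: consistent extensions and countable subadditivity *)

Section ionescu_tulcea.
Local Open Scope ereal_scope.
Context dX (X : measurableType dX) (R : realType) (k : R.-pker X ~> X).

(** The coordinates up to [n] are kept, the [m] next ones are drawn successively from [k], and those
    after [n + m] stay as in the given path. *)
Fixpoint extend_law (m n : nat) : R.-pker (Path X) ~> (Path X) :=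
  match m with
  | 0%N => kdirac (@measurable_id _ _ setT)
  | m'.+1 => kbind (kmap (measurable_coord n) k)
               (kmap (measurable_upd n.+1) (extend_law m' n.+1))
  end.

Lemma extend_law0 n y (A : set (Path X)) : extend_law 0 n y A = \d_y A.
Proof. by []. Qed.

Lemma extend_lawS m n y (A : set (Path X)) :
  extend_law m.+1 n y A =
  \int[k (y n)]_x extend_law m n.+1 (upd y n.+1 x) A.
Proof. by []. Qed.

Lemma dirac_depends n (A : set (Path X)) (y y' : Path X) : depends_on_first n A ->
  (forall i, (i < n)%N -> y i = y' i) -> \d_y A = \d_y' A :> \bar R.
Proof.
move=> dA /dA yy'; rewrite !diracE; congr ((nat_of_bool _)%:R%:E).
by apply/idP/idP; rewrite !inE -yy'.
Qed.

Lemma extend_law_cylinder N m n y A : cylinder N A -> (N <= n.+1)%N ->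
  extend_law m n y A = \d_y A.
Proof.
move=> [mA dA]; elim: m n y => [//|m ih] n y Nn.
rewrite extend_lawS (eq_integral (cst (\d_y A))); last first.
  move=> x _; rewrite ih; last exact: leqW.
  apply: (dirac_depends dA) => i iN; rewrite /upd ltn_eqF//.
  exact: leq_trans iN _.
by rewrite integral_cst//= prob_kernel mule1.
Qed.

(** Consistency: the [j] additional draws only affect coordinates after [n + m], which [A] does not
    read. *)
Lemma extend_law_stable N m j n y A : cylinder N A -> (N <= n + m.+1)%N ->
  extend_law (m + j) n y A = extend_law m n y A.
Proof.
move=> cA; elim: m n y => [|m ih] n y Nn.
  by rewrite !(extend_law_cylinder _ _ cA)// -addn1.
rewrite addSn !extend_lawS; apply: eq_integral => x _.
by rewrite ih// addSnnS.
Qed.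

Definition depth (A : set (Path X)) : nat := xget 0%N [set N | cylinder N A].

Lemma cylinder_depth A : cyl A -> cylinder (depth A) A.
Proof. by move=> [N cA]; rewrite /depth; case: xgetP => [m _ //|/(_ N)]. Qed.

(** From any time [n], drawing [depth A] coordinates fixes all those that [A] reads. By
    [precontentE] any other sufficient number of draws gives the same value. *)
Definition precontent n y (A : set (Path X)) := extend_law (depth A) n y A.

Lemma precontentE N m n y A : cylinder N A -> (N <= n + m.+1)%N ->
  precontent n y A = extend_law m n y A.
Proof.
move=> cA Nnm; rewrite /precontent.
have cA' : cylinder (depth A) A by apply: cylinder_depth; exists N.
rewrite -(@extend_law_stable _ (depth A) m n y _ cA'); last first.
  by rewrite addnS -addSn leq_addl.
by rewrite addnC (extend_law_stable _ _ cA).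
Qed.

Lemma precontent_step n y A : cyl A ->
  precontent n y A = \int[k (y n)]_x precontent n.+1 (upd y n.+1 x) A.
Proof.
move=> [N cA]; rewrite (@precontentE N N.+1 _ _ _ cA); last first.
  by rewrite !addnS ltnW// ltnS leqW// leq_addl.
rewrite extend_lawS; apply: eq_integral => x _; apply/esym/(precontentE _ cA).
by rewrite addnS leqW// leq_addl.
Qed.

Lemma precontent_dirac N n y A : cylinder N A -> (N <= n.+1)%N ->
  precontent n y A = \d_y A.
Proof. by move=> cA Nn; rewrite (@precontentE N 0 _ _ _ cA) ?addn1. Qed.

Lemma measurable_precontent n A : cyl A ->
  measurable_fun setT (fun y => precontent n y A).
Proof.
move=> cA; apply: measurable_kernel.
by case: (cylinder_depth cA).
Qed.

(* If a path violated subadditivity at time [n], some next coordinate would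
   violate it at time [n.+1]; following these choices forever leads to a path
   whose indicator functions violate it. *)
Lemma precontent_sigma_subadditive n y (A : set (Path X)) (F : nat -> set (Path X)) :
  (forall j, cyl (F j)) -> cyl A -> A `<=` \bigcup_j F j ->
  precontent n y A <= \sum_(j <oo) precontent n y (F j).
Proof.
move=> cF cA AF; rewrite leNgt; apply/negP => bad0.
pose bad (p : nat * Path X) :=
  \sum_(j <oo) precontent p.1 p.2 (F j) < precontent p.1 p.2 A.
have step p : bad p -> exists x, bad (p.1.+1, upd p.2 p.1.+1 x).
  move=> badp; apply: contrapT => /forallNP good; move: badp.
  apply/negP; rewrite -leNgt precontent_step//.
  rewrite [leRHS](_ : _ = \sum_(j <oo) \int[k (p.2 p.1)]_x
      precontent p.1.+1 (upd p.2 p.1.+1 x) (F j)); last first.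
    by apply: eq_eseriesr => j _; exact: precontent_step.
  have mupd : measurable_fun setT (fun x => upd p.2 p.1.+1 x).
    exact: (measurable_comp measurableT _ (measurable_upd _) (pair1_measurable _)).
  rewrite -integral_nneseries//; last first.
    by move=> j; exact: (measurableT_comp (measurable_precontent _ (cF j)) mupd).
  apply: ge0_le_integral => //.
  - exact: (measurableT_comp (measurable_precontent _ cA) mupd).
  - apply: ge0_emeasurable_sum => // j _.
    exact: (measurableT_comp (measurable_precontent _ (cF j)) mupd).
  - by move=> x _; rewrite leNgt; apply/negP; exact: good.
pose next (p : nat * Path X) : nat * Path X :=
  (p.1.+1, upd p.2 p.1.+1 (xget point [set x | bad (p.1.+1, upd p.2 p.1.+1 x)])).
pose s i := iter i next (n, y).
have s1 i : (s i).1 = (i + n)%N by elim: i => //= i ->.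
have bads i : bad (s i).
  elim: i => // i /step; rewrite /s/= -/(s i).
  by move=> [x] /(@xgetI _ point [set x | bad ((s i).1.+1, upd (s i).2 (s i).1.+1 x)]).
have sstab i j m : (m <= i + n)%N -> (s (i + j)%N).2 m = (s i).2 m.
  move=> mi; elim: j => [|j]; first by rewrite addn0.
  rewrite addnS => <-; rewrite /s/= -/(s (i + j)%N) {1}/upd s1.
  by rewrite ltn_eqF// ltnS (leq_trans mi)// leq_add2r leq_addr.
(* Coordinates up to [i + n] are frozen from stage [i] on, so the diagonal path [z] agrees with
   [s i] there. At stage [i] the content of a cylinder of length at most [i + n + 1] is therefore
   its indicator at [z]. *)
pose z : Path X := fun m => (s m).2 m.
have sz i m : (m < (i + n).+1)%N -> (s i).2 m = z m.
  rewrite ltnS => mi; rewrite /z -(@sstab m i m) ?leq_addr//.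
  by rewrite addnC sstab.
have ind N i B : cylinder N B -> (N <= (i + n).+1)%N ->
    precontent (s i).1 (s i).2 B = \d_z B.
  move=> cB Ni; rewrite (precontent_dirac _ cB) ?s1//.
  apply: (dirac_depends cB.2) => m mN; apply: sz; exact: leq_trans mN Ni.
have Az : A z.
  have [N cAN] := cA; apply: contrapT => nAz.
  have := bads N; rewrite /bad (ind N _ _ cAN) ?leqW ?leq_addr//.
  rewrite diracE memNset//= ltNge => /negP; apply.
  by apply: nneseries_ge0.
have [j _ Fjz] := AF _ Az.
have [[N cAN] [M cFM]] := (cA, cF j).
have := bads (maxn N M); rewrite /bad (ind N _ _ cAN); last first.
  by rewrite leqW// (leq_trans (leq_maxl N M))// leq_addr.
rewrite diracE mem_set//= ltNge => /negP; apply.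
rewrite (@nneseriesD1 _ _ j)//.
rewrite (ind M _ _ cFM); last first.
  by rewrite leqW// (leq_trans (leq_maxr N M))// leq_addr.
by rewrite diracE mem_set// leeDl// nneseries_ge0.
Qed.

End ionescu_tulcea.

Lemma measurable_cylE dX (X : measurableType dX) :
  @measurable _ (Path X) = <<s @cyl _ X >>.
Proof.
apply/seteqP; split.
  apply: sub_sigma_algebra2 => _ [i _ [B mB <-]].
  by exists i.+1; exact: cylinder_coord.
apply: smallest_sub; first exact: sigma_algebra_measurable.
by move=> A [n []].
Qed.

(** * The law of the chain as a kernel in its starting point *)

Section path_law.
Local Open Scope ereal_scope.
Context dX (X : measurableType dX) (R : realType) (k : R.-pker X ~> X).

(** Only coordinate [0] matters; the others are fillers, redrawn before a cylinder reads them. *)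
Definition start_at (e : X) : Path X := fun=> e.

Lemma measurable_start_at : measurable_fun setT start_at.
Proof. by apply: measurable_to_path => i; exact: measurable_id. Qed.

Section fixed_start.
Variable e : X.

Definition path_content (A : set (CylPath X)) : \bar R :=
  precontent k 0 (start_at e) A.

Let path_content_ge0 A : 0 <= path_content A.
Proof. by rewrite /path_content /precontent. Qed.

Let path_content_semi_additive : measure_function.semi_additive path_content.
Proof.
apply/additive2P.
  rewrite /path_content (@precontentE _ _ _ _ 0 0 _ _ _ (@cylinder0 _ _ _))//.
move=> A B [N cA] [M cB] AB0.
have {}cA := cylinderW (leq_maxl N M) cA.
have {}cB := cylinderW (leq_maxr N M) cB.
(* The two events and their union are evaluated after the same number of draws, where additivity is
   that of a genuine measure. *)
have NM : (maxn N M <= 0 + (maxn N M).+1)%N by [].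
rewrite /path_content (precontentE k _ cA NM) (precontentE k _ cB NM).
rewrite (precontentE k _ (cylinderU cA cB) NM) measureU//.
- by case: cA.
- by case: cB.
Qed.

HB.instance Definition _ := isContent.Build _ (CylPath X) R path_content
  path_content_ge0 path_content_semi_additive.

Let path_content_subadd : measurable_subset_sigma_subadditive path_content.
Proof. by move=> A F mF mA AF; exact: precontent_sigma_subadditive. Qed.

HB.instance Definition _ := Content_SigmaSubAdditive_isMeasure.Build _ R
  (CylPath X) path_content path_content_subadd.

Let G : measurableType _ := g_sigma_algebraType (@measurable _ (CylPath X)).

Let measurable_cyl_path : measurable_fun [set: G] (fun y : G => y : Path X).
Proof.
apply: (@measurability _ _ G (Path X) _ _ (@path_gen dX X)) => //.
move=> _ [_ [i _ [B mB <-]] <-]; rewrite setTI; apply: sub_sigma_algebra.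
by exists i.+1; exact: cylinder_coord.
Qed.

(** The Caratheodory extension of the content, carried by the identity map from the sigma-algebra
    generated by the cylinders to that of [Path X]. *)
Definition path_measure : {measure set (Path X) -> \bar R} :=
  image_law (measure_extension path_content) measurable_cyl_path.

Lemma path_measureE N m (A : set (Path X)) : cylinder N A -> (N <= m.+1)%N ->
  path_measure A = extend_law k m 0 (start_at e) A.
Proof.
move=> cA Nm; rewrite /path_measure/= /image_law /measure_extension/=.
rewrite measurable_mu_extE; last by exists N.
exact: (precontentE _ _ cA).
Qed.

End fixed_start.

Lemma path_measure_setT e : path_measure e setT = 1.
Proof.
have cT : cylinder 0 [set: Path X] by split.
by rewrite (@path_measureE e _ 0 _ cT)// prob_kernel.
Qed.

Definition path_kernel (e : X) : {measure set (Path X) -> \bar R} :=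
  path_measure e.

(** Dynkin induction from the cylinders, a generating pi-system on which the value is that of the
    kernel [extend_law]. *)
Let measurable_path_kernel U : measurable U ->
  measurable_fun [set: X] (path_kernel ^~ U).
Proof.
rewrite measurable_cylE; move: U.
apply: (@dynkin_induction _ (Path X) _
  (fun U => measurable_fun setT (path_kernel ^~ U)) (measurable_cylE X)).
- by move=> A B cA cB; exact: (@measurableI _ (CylPath X)).
- rewrite (_ : path_kernel^~ _ = cst 1)//.
  by apply/funext => e; exact: path_measure_setT.
- move=> A [N cA].
  rewrite (_ : path_kernel^~ _ = fun e => extend_law k N 0 (start_at e) A).
    apply: (measurableT_comp (measurable_kernel _ _ _)) => //; first by case: cA.
    exact: measurable_start_at.
  by apply/funext => e; rewrite /path_kernel (@path_measureE e _ N _ cA).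
- move=> S mS mfS.
  rewrite (_ : path_kernel^~ _ = fun e => 1 - path_kernel e S).
    exact: emeasurable_funB.
  apply/funext => e; rewrite /path_kernel -setTD measureD//.
    by rewrite setTI; congr (_ - _); rewrite -(path_measure_setT e).
  by apply: le_lt_trans (ltry 1); rewrite -(path_measure_setT e).
- move=> F mF tF mfF.
  rewrite (_ : path_kernel^~ _ = fun e => \sum_(n <oo) path_kernel e (F n)).
    exact: ge0_emeasurable_sum.
  by apply/funext => e; rewrite measure_bigcup//; apply: eq_eseriesl => i; rewrite in_setT.
Qed.

HB.instance Definition _ := isKernel.Build _ _ _ _ _ path_kernel
  measurable_path_kernel.

Let path_kernel_prob e : path_kernel e setT = 1.
Proof. exact: path_measure_setT. Qed.

HB.instance Definition _ :=
  Kernel_isProbability.Build _ _ _ _ _ path_kernel path_kernel_prob.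

End path_law.

Section unit_mass.
Local Open Scope ereal_scope.
Context d (T : measurableType d) (R : realType) (m : {measure set T -> \bar R}).

(** An alias whose proof argument gives a measure of total mass one the structure of a
    probability. *)
Definition unit_mass of m setT = 1 : set T -> \bar R := m.

Hypothesis m1 : m setT = 1.

HB.instance Definition _ := isMeasure.Build _ _ _ (unit_mass m1)
  (measure0 m) (@measure_ge0 _ _ _ m) (@measure_semi_sigma_additive _ _ _ m).

HB.instance Definition _ := Measure_isProbability.Build _ _ _ (unit_mass m1) m1.

End unit_mass.

(** * Markov property of the constructed chain *)

Section markov_chain_law.
Local Open Scope ereal_scope.
Context dX (X : measurableType dX) (R : realType) (k : R.-pker X ~> X).

Lemma path_kernel_start e (A : set X) : measurable A ->
  path_kernel k e ((fun y : Path X => y 0%N) @^-1` A) = \d_e A.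
Proof.
move=> mA; rewrite [LHS](@path_measureE _ _ _ _ _ 1 0)//.
exact: cylinder_coord.
Qed.

(** The recursion defining [extend_law] isolates the first draw; the Markov property needs the last
    one. *)
Lemma extend_law_last m n y (B : set (Path X)) : measurable B ->
  extend_law k m.+1 n y B =
  \int[extend_law k m n y]_z extend_law k 1 (n + m) z B.
Proof.
move=> mB; elim: m n y => [|m ih] n y.
  rewrite addn0 [RHS]integral_dirac//; last exact: measurable_kernel.
  by rewrite [X in _ = X * _]diracT mul1e.
rewrite extend_lawS; under eq_integral do rewrite ih addSnnS.
by rewrite [RHS]integral_kcomp//; exact: measurable_kernel.
Qed.

(** The event is read after [n.+1] draws. Integrating out the last one, which [E] does not see,
    leaves [k (y n) A] on [E]. *)
Lemma path_kernel_markov n (A : set X) (E : set (Path X)) e :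
  measurable A -> cylinder n.+1 E ->
  path_kernel k e ((fun y : Path X => y n.+1) @^-1` A `&` E) =
  \int[path_kernel k e]_(y in E) k (y n) A.
Proof.
move=> mA cE; have [mE dE] := cE.
have cAE : cylinder n.+2 ((fun y : Path X => y n.+1) @^-1` A `&` E).
  by apply: cylinderI; [exact: cylinder_coord|exact: cylinderW cE].
rewrite [LHS](@path_measureE _ _ _ _ _ _ n.+1 _ cAE)// extend_law_last; last by case: cAE.
pose F (y : Path X) := (\1_E y)%:E * k (y n) A.
have mkn : measurable_fun setT (fun y : Path X => k (y n) A).
  exact: (measurableT_comp (measurable_kernel k _ mA) (measurable_coord n)).
have mF : measurable_fun setT F.
  by apply: emeasurable_funM => //; apply/measurable_EFinP; exact: measurable_indic.
have F0 y : 0 <= F y by rewrite mule_ge0// lee_fin.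
have dF : depends_on_first n.+1 F.
  move=> y y' yy'; rewrite /F yy'//; congr (_%:E * _).
  by rewrite !indicE; congr (nat_of_bool _)%:R; apply/idP/idP; rewrite !inE (dE _ _ yy').
transitivity (\int[extend_law k n 0 (start_at e)]_y F y).
  apply: eq_integral => z _; rewrite add0n extend_lawS.
  rewrite (eq_integral (fun x => (\1_E z)%:E * (\1_A x)%:E)); last first.
    move=> x _; rewrite extend_law0 diracE !indicE in_setI -mulnb natrM EFinM.
    rewrite muleC; congr ((nat_of_bool _)%:R%:E * (nat_of_bool _)%:R%:E).
      apply/idP/idP; rewrite !inE (dE _ z)// => i iN.
        by rewrite /upd ltn_eqF.
      by rewrite /upd ltn_eqF.
    by apply/idP/idP; rewrite !inE /= /upd eqxx.
  rewrite ge0_integralZl//; last by apply/measurable_EFinP; exact: measurable_indic.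
  by rewrite integral_indic// setIT.
(* The chain law and [extend_law k n] agree only on events of the first [n.+1] coordinates, so they
   are compared through their images under [trunc n.+1], which [F] does not distinguish from the
   laws themselves. *)
transitivity (\int[image_law (path_kernel k e) (measurable_trunc n.+1)]_y F y).
  transitivity (\int[image_law (extend_law k n 0 (start_at e)) (measurable_trunc n.+1)]_y F y).
    rewrite ge0_integral_image_law// preimage_setT.
    by apply: eq_integral => y _; rewrite depends_trunc.
  apply: eq_measure_integral => B mB _; apply/esym.
  exact: (@path_measureE _ _ _ _ _ n.+1 n _ (cylinder_trunc _ mB)).
rewrite ge0_integral_image_law// preimage_setT [RHS]integral_mkcond.
apply: eq_integral => y _; rewrite depends_trunc// /F patchE indicE.
by case: ifPn => _; rewrite ?mul1e ?mul0e.
Qed.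

End markov_chain_law.

(** * Mixtures of kernels and generated sigma-algebras *)

Section mixture.
Local Open Scope ereal_scope.
Context d1 d2 (X : measurableType d1) (Y : measurableType d2) (R : realType).

Definition kcst d0 (S : measurableType d0) (rho : probability X R) : R.-pker S ~> X :=
  kprobability (@measurable_cst _ _ S (pprobability X R) setT rho).

Lemma mixture_setT (rho : probability X R) (k : R.-pker X ~> Y) :
  kbind (kcst unit rho) (kmap measurable_snd k) tt setT = 1.
Proof. exact: prob_kernel. Qed.

Definition mixture (rho : probability X R) (k : R.-pker X ~> Y) : probability Y R :=
  unit_mass (mixture_setT rho k).

Lemma integral_mixture rho k (f : Y -> \bar R) : (forall y, 0 <= f y) ->
  measurable_fun setT f ->
  \int[mixture rho k]_y f y = \int[rho]_x \int[k x]_y f y.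
Proof. by move=> f0 mf; rewrite [LHS]integral_kcomp. Qed.

End mixture.

Lemma bigcap_IIS T (F : nat -> set T) n :
  \bigcap_(i in `I_n.+1) F i = F n `&` \bigcap_(i in `I_n) F i.
Proof. by rewrite IIS bigcap_setU bigcap_set1 setIC. Qed.

(** Translates the conditioning sigma-algebras of [hmm_realization] and [is_predictor] into
    cylinders on path space. *)
Lemma sigma_gen_cylinder dO (O : measurableType dO) dY (Y : measurableType dY)
    (phi : O -> Path Y) n :
  sigma_gen `I_n (fun i w => phi w i) =
  [set phi @^-1` E | E in cylinder n].
Proof.
apply/seteqP; split.
  apply: smallest_sub.
    split.
    - by exists set0; [exact: cylinder0|rewrite preimage_set0].
    - move=> _ [E cE <-]; exists (~` E); first exact: cylinderC.
      by rewrite setTD preimage_setC.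
    - move=> F mF.
      have /boolp.choice[G cG] i : exists E, cylinder n E /\ phi @^-1` E = F i.
        by case: (mF i) => E; exists E.
      exists (\bigcup_i G i); last first.
        by rewrite preimage_bigcup; apply: eq_bigcupr => i _; case: (cG i).
      split; first by apply: bigcupT_measurable => i; case: (cG i) => -[].
      move=> y y' yy'; apply/propext; split=> -[i _ Gi]; exists i => //.
        by case: (cG i) => -[_ dG] _; rewrite -(dG _ _ yy').
      by case: (cG i) => -[_ dG] _; rewrite (dG _ _ yy').
  move=> _ [i /= ni [B mB <-]].
  exists ((fun y : Path Y => y i) @^-1` B) => //.
  by apply: cylinderW (cylinder_coord i mB).
move=> _ [E [mE dE] <-]; rewrite -(trunc_cylinder dE).
pose G := \bigcup_(i in `I_n) [set (fun w => phi w i) @^-1` A | A in measurable].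
(* The coordinates of [trunc n] from [n] on are constant, so measurability for the sigma-algebra
   generated by the first [n] variables is enough. *)
suff : measurable_fun setT (fun w : g_sigma_algebraType G => trunc n (phi w)).
  by move=> /(_ measurableT _ mE); rewrite setTI.
apply: measurable_to_path => i; rewrite /trunc; case: (ltnP i n) => // ni _ A mA.
by rewrite setTI; apply: sub_sigma_algebra; exists i => //; exists A.
Qed.

(** * A realization of the model for an arbitrary initial law *)

Section realization.
Local Open Scope ereal_scope.
Context (R : realType) dX dZ (X : measurableType dX) (Z : measurableType dZ)
  (T : R.-pker X ~> X) (Q : probability Z R).

Definition state_law (rho : probability X R) : probability (Path X) R :=
  mixture rho (path_kernel T).

(** An i.i.d. sequence is obtained as the Markov chain whose kernel and initial law are both [Q]. *)
Definition noise_law : probability (Path Z) R :=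
  mixture Q (path_kernel (kcst Z Q)).

Definition hmm_law (rho : probability X R) : probability (Path X * Path Z)%type R :=
  (state_law rho \x noise_law)%E.

Lemma state_lawE rho A : state_law rho A = \int[rho]_x path_kernel T x A.
Proof. by []. Qed.

Lemma noise_lawE A : noise_law A = \int[Q]_x path_kernel (kcst Z Q) x A.
Proof. by []. Qed.

Lemma noise_law_prod n (C : nat -> set Z) : (forall i, measurable (C i)) ->
  noise_law (\bigcap_(i in `I_n) ((fun z : Path Z => z i) @^-1` C i)) =
  \prod_(i < n) Q (C i).
Proof.
move=> mC; have cC m : cylinder m (\bigcap_(i in `I_m) ((fun z : Path Z => z i) @^-1` C i)).
  elim: m => [|m ih]; first by rewrite II0 bigcap_set0.
  rewrite bigcap_IIS; apply: cylinderI; first exact: cylinder_coord.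
  exact: cylinderW ih.
elim: n => [|n ih].
  by rewrite II0 bigcap_set0 big_ord0; exact: probability_setT.
rewrite bigcap_IIS big_ord_recr [RHS]/= -ih.
case: n ih => [|n] ih.
  rewrite II0 bigcap_set0 setIT (_ : noise_law setT = 1); last exact: probability_setT.
  rewrite mul1e noise_lawE.
  under eq_integral do rewrite path_kernel_start//.
  by rewrite integral_indic// setIT.
rewrite !noise_lawE.
under eq_integral do rewrite (path_kernel_markov _ _ (mC _) (cC _)).
rewrite muleC -ge0_integralZl//; last first.
  by apply: measurable_kernel; case: (cC n.+1).
apply: eq_integral => z _.
rewrite (eq_integral (cst (Q (C n.+1))))// integral_cst//.
by case: (cC n.+1).
Qed.

Lemma hmm_lawX rho A B : measurable A -> measurable B ->
  hmm_law rho (A `*` B) = state_law rho A * noise_law B.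
Proof. by move=> mA mB; exact: product_measure1E. Qed.

Lemma hmm_law_realization rho :
  hmm_realization T Q rho (hmm_law rho) (fun n w => w.1 n) (fun n w => w.2 n).
Proof.
have m1 n : measurable_fun setT (fun w : Path X * Path Z => w.1 n).
  exact: (measurableT_comp (measurable_coord n) measurable_fst).
have m2 n : measurable_fun setT (fun w : Path X * Path Z => w.2 n).
  exact: (measurableT_comp (measurable_coord n) measurable_snd).
have law1 (E : set (Path X)) : measurable E -> hmm_law rho (fst @^-1` E) = state_law rho E.
  move=> mE; rewrite (_ : fst @^-1` E = E `*` setT); last first.
    by apply/seteqP; split=> // w [].
  rewrite hmm_lawX// (_ : noise_law setT = 1); first by rewrite mule1.
  exact: probability_setT.
split => //.
- move=> A mA; rewrite (_ : _ @^-1` A =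
    fst @^-1` ((fun x : Path X => x 0%N) @^-1` A))// law1; last first.
    by case: (cylinder_coord 0 mA).
  rewrite state_lawE.
  under eq_integral do rewrite path_kernel_start//.
  by rewrite integral_indic// setIT.
- move=> n A E mA; rewrite (@sigma_gen_cylinder _ _ _ X fst) => -[E' cE' <-].
  have [mE' dE'] := cE'.
  rewrite (_ : _ `&` _ =
    fst @^-1` ((fun x : Path X => x n.+1) @^-1` A `&` E'))// law1; last first.
    by apply: measurableI => //; case: (cylinder_coord n.+1 mA).
  rewrite state_lawE.
  under eq_integral do rewrite (path_kernel_markov _ _ mA cE').
  have mT : measurable_fun setT (fun y : Path X => T (y n) A).
    exact: (measurableT_comp (measurable_kernel T _ mA) (measurable_coord n)).
  transitivity (\int[state_law rho]_(y in E') T (y n) A).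
    rewrite [RHS]integral_mkcond integral_mixture//.
    - by apply: eq_integral => x _; rewrite [LHS]integral_mkcond.
    - by move=> y; rewrite patchE; case: ifP.
    - by apply/(measurable_restrictT _ _).1 => //; exact: measurable_funTS.
  transitivity (\int[image_law (hmm_law rho) measurable_fst]_(y in E') T (y n) A).
    by apply: eq_measure_integral => B mB _; exact: (esym (law1 B mB)).
  by rewrite ge0_integral_image_law//; exact: measurable_funTS.
- move=> n A C mA mC.
  have mAn : measurable (\bigcap_(i in `I_n) ((fun x : Path X => x i) @^-1` A i)).
    apply: bigcap_measurableType => i _.
    by case: (cylinder_coord i (mA i)).
  have mCn : measurable (\bigcap_(i in `I_n) ((fun x : Path Z => x i) @^-1` C i)).
    apply: bigcap_measurableType => i _.
    by case: (cylinder_coord i (mC i)).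
  rewrite -(noise_law_prod n mC) [X in _ = X * _](law1 _ mAn).
  rewrite -(hmm_lawX rho mAn mCn).
  congr (hmm_law rho _); apply/seteqP; split => w.
    by move=> w12; split=> i /w12[].
  by move=> [w1 w2] i ni; split; [exact: w1|exact: w2].
Qed.

(** The probability of [A] is the integral over the initial law of a function [G] of the starting
    point alone. If the [nu]-integral of [G] is zero, then [G] vanishes [nu]-a.e., hence
    [mu]-a.e. *)
Lemma hmm_law_abs_cont (mu nu : probability X R) : abs_cont mu nu ->
  forall A, measurable A -> hmm_law nu A = 0 -> hmm_law mu A = 0.
Proof.
move=> munu A mA.
pose G e := \int[path_kernel T e]_x noise_law (xsection A x).
have mxs : measurable_fun setT (fun x => noise_law (xsection A x)).
  exact: measurable_fun_xsection.
have lawE rho : hmm_law rho A = \int[rho]_e G e by rewrite -integral_mixture.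
have mG : measurable_fun setT G.
  by apply: measurable_fun_integral_kernel => //; exact: measurable_kernel.
have G0 e : 0 <= G e by exact: integral_ge0.
pose S := G @^-1` (~` [set 0]).
have mS : measurable S.
  by rewrite -[S]setTI; apply: mG => //; exact/measurableC/emeasurable_set1.
rewrite !lawE => nuG0; apply/eqP; rewrite eq_le integral_ge0// andbT.
have muS : mu S = 0.
  apply: munu => //.
  have /ae_eq_integral_abs : \int[nu]_e `|G e| = 0.
    by under eq_integral do rewrite gee0_abs//.
  move=> /(_ measurableT mG)[N [mN N0 GN]].
  apply: (subset_measure0 _ _ _ N0) => // e /= Ge; apply: GN => /=.
  by move/(_ I).
rewrite (_ : \int[mu]_e G e = 0)//.
rewrite (ge0_negligible_integral mS measurableT)//.
by apply: integral0_eq => e [_ /= /contrapT].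
Qed.

End realization.

(** * Integrals against restricted and composed measures *)

Section integral_tools.
Local Open Scope ereal_scope.
Context d1 (O : measurableType d1) (R : realType).

Lemma ge0_integral_mrestr (m : {measure set O -> \bar R}) (E : set O)
    (mE : measurable E) (f : O -> \bar R) :
  measurable_fun setT f -> (forall w, 0 <= f w) ->
  \int[mrestr m mE]_w f w = \int[m]_(w in E) f w.
Proof.
move=> mf f0; rewrite [LHS](ge0_negligible_integral (measurableC mE))//; last first.
  by rewrite /= /mrestr setICl measure0.
rewrite setTD setCK; apply: eq_measure_integral => A mA AE.
by rewrite /= /mrestr setIidl.
Qed.

Section constant_kernel.
Context d2 (S : measurableType d2) (m : {finite_measure set O -> \bar R}).

Definition kconst (s : S) : {measure set O -> \bar R} := m.

Let measurable_kconst U : measurable U -> measurable_fun [set: S] (kconst ^~ U).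
Proof. by move=> mU; exact: measurable_cst. Qed.

HB.instance Definition _ := isKernel.Build _ _ _ _ _ kconst measurable_kconst.

Let kconst_uub : measure_fam_uub kconst.
Proof.
exists (fine (m setT) + 1)%R => s; rewrite /kconst.
by rewrite EFinD fineK ?fin_num_measure// lteDl ?lte01 ?fin_num_measure.
Qed.

HB.instance Definition _ := Kernel_isFinite.Build _ _ _ _ R kconst kconst_uub.

End constant_kernel.

(** Extends the disintegration of [mX] from events to functions: [m], seen as a constant kernel on
    [unit], turns it into a composition of kernels. [m] need not be normalized, as it will be a law
    restricted to an event. *)
Lemma ge0_integral_compose d2 (X : measurableType d2)
    (m : {finite_measure set O -> \bar R}) (k : R.-pker O ~> X)
    (mX : {measure set X -> \bar R}) (f : X -> \bar R) :
  (forall A, measurable A -> mX A = \int[m]_w k w A) ->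
  measurable_fun setT f -> (forall x, 0 <= f x) ->
  \int[mX]_x f x = \int[m]_w \int[k w]_x f x.
Proof.
move=> mXE mf f0.
rewrite -(@integral_kcomp _ _ _ unit O X R (@kconst _ unit m)
  (kmap measurable_snd k) tt)//.
by apply: eq_measure_integral => A mA _; exact: mXE.
Qed.

End integral_tools.

(** * Measures on path space are determined by rectangles *)

Section path_uniqueness.
Local Open Scope ereal_scope.
Context dY (Y : measurableType dY) (R : realType) (G : set (set Y)).
Hypothesis GE : @measurable _ Y = <<s G >>.
Hypothesis GI : setI_closed G.
Hypothesis GT : G setT.

Definition path_rect : set (set (Path Y)) :=
  [set A | exists B : nat -> set Y, [/\ forall i, G (B i),
    exists m, forall i, (m <= i)%N -> B i = setT &
    A = \bigcap_i ((fun y : Path Y => y i) @^-1` B i)]].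

Lemma path_rect_setI : setI_closed path_rect.
Proof.
move=> _ _ [B [GB [m Bm] ->]] [C [GC [n Cn] ->]].
exists (fun i => B i `&` C i); split.
- by move=> i; exact: GI.
- exists (maxn m n) => i; rewrite geq_max => /andP[mi ni].
  by rewrite Bm// Cn// setTI.
- by rewrite bigcapI.
Qed.

Lemma measurable_path_rectE : @measurable _ (Path Y) = <<s path_rect >>.
Proof.
have mG B : G B -> measurable B by move=> GB; rewrite GE; exact: sub_sigma_algebra.
apply/seteqP; split; last first.
  apply: smallest_sub; first exact: sigma_algebra_measurable.
  move=> _ [B [GB _ ->]]; apply: bigcap_measurableType => i _.
  by case: (cylinder_coord i (mG _ (GB i))).
apply: smallest_sub; first exact: smallest_sigma_algebra.
move=> _ [i _ [B mB <-]].
suff : measurable_fun setT (fun y : g_sigma_algebraType path_rect => y i).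
  by move=> /(_ measurableT _ mB); rewrite setTI.
apply: (@measurability _ _ (g_sigma_algebraType path_rect) Y _ _ G) => //.
move=> _ [C GC <-]; rewrite setTI; apply: sub_sigma_algebra.
exists (fun j => if j == i then C else setT); split.
- by move=> j; case: ifP.
- by exists i.+1 => j ij; rewrite gtn_eqF.
- apply/seteqP; split => y /=.
    by move=> Cy j _ /=; case: eqP => // ->.
  by move=> /(_ i I); rewrite /= eqxx.
Qed.

(** Rectangles with sides in the pi-system [G], almost all equal to [setT], form a generating
    pi-system, so uniqueness of measures applies. *)
Lemma path_measure_unique (m1 m2 : {measure set (Path Y) -> \bar R}) :
  m1 setT < +oo ->
  (forall B : nat -> set Y, (forall i, G (B i)) ->
    (exists m, forall i, (m <= i)%N -> B i = setT) ->
    m1 (\bigcap_i ((fun y : Path Y => y i) @^-1` B i)) =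
    m2 (\bigcap_i ((fun y : Path Y => y i) @^-1` B i))) ->
  forall A, measurable A -> m1 A = m2 A.
Proof.
move=> m1oo m12 A mA.
apply: (measure_unique path_rect (fun=> setT)) => //.
- exact: measurable_path_rectE.
- exact: path_rect_setI.
- move=> _; exists (fun=> setT); split => //; first by exists 0%N.
  by apply/seteqP; split.
- by rewrite bigcup_const.
- by move=> _ [B [GB Bm ->]]; exact: m12.
Qed.

End path_uniqueness.

Lemma bigcap_stationary T (F : nat -> set T) m :
  (forall i, (m <= i)%N -> F i = setT) -> \bigcap_i F i = \bigcap_(i in `I_m) F i.
Proof.
move=> Fm; apply/seteqP; split => [x Fx i _|x Fx i _]; first exact: Fx.
by have [mi|im] := leqP m i; [rewrite Fm|exact: Fx].
Qed.

(** * Uniqueness in law of realizations *)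

Section realization_law.
Local Open Scope ereal_scope.
Context (R : realType) dX dZ (X : measurableType dX) (Z : measurableType dZ)
  (T : R.-pker X ~> X) (Q : probability Z R) (rho : probability X R).

Definition joint_path (O : Type) (Xs : nat -> O -> X) (Zs : nat -> O -> Z)
  (w : O) : Path (X * Z)%type := fun i => (Xs i w, Zs i w).

Lemma measurable_joint_path dO (O : measurableType dO) (Xs : nat -> O -> X)
    (Zs : nat -> O -> Z) :
  (forall n, measurable_fun setT (Xs n)) -> (forall n, measurable_fun setT (Zs n)) ->
  measurable_fun setT (joint_path Xs Zs).
Proof. by move=> mX mZ; apply: measurable_to_path => i; exact: measurable_fun_pair. Qed.

Definition rectangles : set (set (X * Z)) :=
  [set A `*` C | A in measurable & C in measurable].

Lemma rectangles_setI : setI_closed rectangles.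
Proof.
move=> _ _ [A mA [C mC <-]] [A' mA' [C' mC' <-]].
exists (A `&` A'); first exact: measurableI.
exists (C `&` C'); first exact: measurableI.
by rewrite setXI.
Qed.

Lemma rectangles_setT : rectangles setT.
Proof. by exists setT => //; exists setT => //; rewrite setXTT. Qed.

Section fixed_realization.
Context dO (O : measurableType dO) (P : probability O R)
  (Xs : nat -> O -> X) (Zs : nat -> O -> Z).
Hypothesis real : hmm_realization T Q rho P Xs Zs.

Lemma realization_states_step n (A : set X) (E : set O) (mE : measurable E)
    (mX : measurable_fun setT (Xs n)) :
  measurable A -> sigma_gen `I_n.+1 Xs E ->
  P (Xs n.+1 @^-1` A `&` E) =
  \int[image_law (mrestr P mE) mX]_x T x A.
Proof.
move=> mA sE; have [_ _ _ -> // _] := real.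
have mT : measurable_fun setT (fun x => T x A) by exact: measurable_kernel.
rewrite ge0_integral_image_law// preimage_setT ge0_integral_mrestr//.
exact: (measurableT_comp mT mX).
Qed.

Lemma measurable_states_rect n (A : nat -> set X) : (forall i, measurable (A i)) ->
  measurable (\bigcap_(i in `I_n) Xs i @^-1` A i).
Proof.
move=> mA; apply: bigcap_measurableType => i _.
by rewrite -[X in measurable X]setTI; case: real => mX _ _ _ _; exact: mX.
Qed.

Lemma sigma_gen_states_rect n (A : nat -> set X) : (forall i, measurable (A i)) ->
  sigma_gen `I_n Xs (\bigcap_(i in `I_n) Xs i @^-1` A i).
Proof.
move=> mA; pose phi w : Path X := fun i => Xs i w.
rewrite (@sigma_gen_cylinder _ _ _ X phi).
exists (\bigcap_(i in `I_n) (fun x : Path X => x i) @^-1` A i) => //.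
elim: n => [|n ih]; first by rewrite II0 bigcap_set0.
rewrite bigcap_IIS; apply: cylinderI; first exact: cylinder_coord.
exact: cylinderW ih.
Qed.

End fixed_realization.

Lemma realization_states_unique dO (O : measurableType dO) (P : probability O R)
    (Xs : nat -> O -> X) (Zs : nat -> O -> Z)
    dO' (O' : measurableType dO') (P' : probability O' R)
    (Xs' : nat -> O' -> X) (Zs' : nat -> O' -> Z) :
  hmm_realization T Q rho P Xs Zs -> hmm_realization T Q rho P' Xs' Zs' ->
  forall n (A : nat -> set X), (forall i, measurable (A i)) ->
  P (\bigcap_(i in `I_n) Xs i @^-1` A i) = P' (\bigcap_(i in `I_n) Xs' i @^-1` A i).
Proof.
move=> real real' n A; elim: n A => [|n ih] A mA.
  by rewrite II0 !bigcap_set0 !probability_setT.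
rewrite !bigcap_IIS; case: n ih => [|n] ih.
  rewrite II0 !bigcap_set0 !setIT.
  by case: real real' => _ _ -> // _ _ [_ _ -> //].
have mE := measurable_states_rect real n.+1 mA.
have mE' := measurable_states_rect real' n.+1 mA.
have mX : measurable_fun setT (Xs n) by case: real.
have mX' : measurable_fun setT (Xs' n) by case: real'.
rewrite (realization_states_step real mE mX (mA _)); last first.
  exact: sigma_gen_states_rect.
rewrite (realization_states_step real' mE' mX' (mA _)); last first.
  exact: sigma_gen_states_rect.
apply: eq_measure_integral => B mB _; rewrite /= /image_law /= /mrestr.
(* The integral of [T] is taken against the law of state [n] restricted to a rectangle. Its value at
   [B] is the probability of the rectangle with [B] intersected into its last side, covered by the
   induction hypothesis. *)
pose A' i := if i == n then A n `&` B else A i.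
have mA' i : measurable (A' i) by rewrite /A'; case: ifP => // _; exact: measurableI.
have rectE U (V : nat -> U -> X) : V n @^-1` B `&` \bigcap_(i in `I_n.+1) V i @^-1` A i =
    \bigcap_(i in `I_n.+1) V i @^-1` A' i.
  apply/seteqP; split => [w [Bw Aw] i ni|w A'w].
    by rewrite /A'; case: eqP => [->|_]; [split => //; exact: (Aw n (ltnSn n))|exact: Aw].
  have := A'w n (ltnSn n); rewrite /A' /= eqxx => -[_ Bw]; split => //.
  by move=> i ni; have := A'w i ni; rewrite /A' /=; case: eqP => [->[]|].
by rewrite !rectE; exact: ih.
Qed.

(** The product formula reduces rectangles of states and noises to rectangles of states. This lets
    an arbitrary realization be replaced by the constructed one. *)
Lemma realization_law_unique dO (O : measurableType dO) (P : probability O R)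
    (Xs : nat -> O -> X) (Zs : nat -> O -> Z)
    dO' (O' : measurableType dO') (P' : probability O' R)
    (Xs' : nat -> O' -> X) (Zs' : nat -> O' -> Z) :
  hmm_realization T Q rho P Xs Zs -> hmm_realization T Q rho P' Xs' Zs' ->
  forall A, measurable A ->
  P (joint_path Xs Zs @^-1` A) = P' (joint_path Xs' Zs' @^-1` A).
Proof.
move=> real real'.
have mj : measurable_fun setT (joint_path Xs Zs).
  by case: real => mX mZ _ _ _; exact: measurable_joint_path.
have mj' : measurable_fun setT (joint_path Xs' Zs').
  by case: real' => mX mZ _ _ _; exact: measurable_joint_path.
apply: (@path_measure_unique _ (X * Z)%type R rectangles
  (measurable_prod_measurableType X Z) rectangles_setI rectangles_setT
  (image_law P mj) (image_law P' mj')).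
  by rewrite /image_law/= preimage_setT [ltLHS]probability_setT ltry.
move=> B rB [m Bm]; rewrite /image_law/= (bigcap_stationary (m := m)); last first.
  by move=> i /Bm ->.
have /boolp.choice[A /boolp.choice[C AC]] i :
    exists A, exists C, [/\ measurable A, measurable C & B i = A `*` C].
  by case: (rB i) => A mA [C mC <-]; exists A, C.
have mA i : measurable (A i) by case: (AC i).
have mC i : measurable (C i) by case: (AC i).
have rectE U (V : nat -> U -> X) (W : nat -> U -> Z) : joint_path V W @^-1`
    (\bigcap_(i in `I_m) (fun y : Path (X * Z)%type => y i) @^-1` B i) =
    \bigcap_(i in `I_m) (V i @^-1` A i `&` W i @^-1` C i).
  apply/seteqP; split => w Bw i im; have := Bw i im; case: (AC i) => _ _;
    by rewrite /preimage/= => ->.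
have [_ _ _ _ prodE] := real; have [_ _ _ _ prodE'] := real'.
rewrite !rectE prodE// prodE'//; congr (_ * _).
exact: realization_states_unique real real' m A mA.
Qed.

End realization_law.

Section finite_mass.
Local Open Scope ereal_scope.
Context d (T : measurableType d) (R : realType) (m : {measure set T -> \bar R}).

Definition finite_mass of m setT < +oo : set T -> \bar R := m.

Hypothesis moo : m setT < +oo.

HB.instance Definition _ := isMeasure.Build _ _ _ (finite_mass moo)
  (measure0 m) (@measure_ge0 _ _ _ m) (@measure_semi_sigma_additive _ _ _ m).

Let finite_mass_fin : fin_num_fun (finite_mass moo).
Proof. exact: lty_fin_num_fun. Qed.

HB.instance Definition _ := Measure_isFinite.Build _ _ _ (finite_mass moo)
  finite_mass_fin.

End finite_mass.

(** * The conditional law of the next observation *)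

Section observation.
Local Open Scope ereal_scope.
Context (R : realType) dX dY dZ (X : measurableType dX) (Y : measurableType dY)
  (Z : measurableType dZ) (T : R.-pker X ~> X) (Q : probability Z R)
  (h : X -> Z -> Y).
Hypothesis mh : measurable_fun setT (fun p : X * Z => h p.1 p.2).

Lemma measurable_obs_at x : measurable_fun setT (h x).
Proof. exact: (measurable_comp measurableT _ mh (pair1_measurable x)). Qed.

Definition obs_kernel (x : X) : {measure set Y -> \bar R} :=
  image_law Q (measurable_obs_at x).

Let measurable_obs_kernel U : measurable U ->
  measurable_fun [set: X] (obs_kernel ^~ U).
Proof.
move=> mU; have mhU : measurable ((fun p : X * Z => h p.1 p.2) @^-1` U).
  by rewrite -[X in measurable X]setTI; exact: mh.
have := measurable_fun_xsection Q mhU; apply: eq_measurable_fun => x _.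
by congr (Q _); apply/seteqP; split => z; rewrite /xsection/= inE.
Qed.

HB.instance Definition _ := isKernel.Build _ _ _ _ _ obs_kernel
  measurable_obs_kernel.

Let obs_kernel_prob x : obs_kernel x setT = 1.
Proof. by rewrite /obs_kernel/= /image_law preimage_setT; exact: probability_setT. Qed.

HB.instance Definition _ := Kernel_isProbability.Build _ _ _ _ _ obs_kernel
  obs_kernel_prob.

Definition next_obs (Phi : R.-pker (Path Y) ~> X) : R.-pker (Path Y) ~> Y :=
  kbind Phi (kmap measurable_snd obs_kernel).

Lemma next_obsE Phi y B : next_obs Phi y B = \int[Phi y]_x Q (h x @^-1` B).
Proof. by []. Qed.

Lemma next_obs_depends n (Phi : R.-pker (Path Y) ~> X) :
  depends_on_first n Phi -> depends_on_first n (fun y => next_obs Phi y : set Y -> \bar R).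
Proof. by move=> dPhi y y' yy'; apply/funext => B; rewrite !next_obsE (dPhi _ _ yy'). Qed.

Definition obs_path (u : Path (X * Z)%type) : Path Y := fun i => h (u i).1 (u i).2.

Lemma measurable_obs_path : measurable_fun setT obs_path.
Proof.
apply: measurable_to_path => i.
exact: (measurableT_comp mh (measurable_coord i)).
Qed.

(** Keeps the states up to time [n] and the noises before [n]. It generates the information from
    which the noise at time [n] is independent. *)
Definition before_noise n (u : Path (X * Z)%type) : Path (X * Z)%type :=
  fun i => if (i < n)%N then u i else
    if i == n then ((u n).1, point) else point.

Lemma measurable_before_noise n : measurable_fun setT (before_noise n).
Proof.
apply: measurable_to_path => i; rewrite /before_noise.
case: (i < n)%N; first exact: measurable_coord.
case: (i == n) => //; apply: measurable_fun_pair => //.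
exact: (measurableT_comp measurable_fst (measurable_coord n)).
Qed.

Section fixed_realization.
Context (rho : probability X R) dO (O : measurableType dO) (P : probability O R)
  (Xs : nat -> O -> X) (Zs : nat -> O -> Z).
Hypothesis real : hmm_realization T Q rho P Xs Zs.
Let W : O -> Path (X * Z)%type := joint_path Xs Zs.

Let mW : measurable_fun setT W.
Proof. by case: real => mX mZ _ _ _; exact: measurable_joint_path. Qed.

Let mZC n C : measurable C -> measurable (Zs n @^-1` C).
Proof.
by move=> mC; rewrite -[X in measurable X]setTI; case: real => _ mZ _ _ _; exact: mZ.
Qed.

(** Both sides are finite measures in [H]; on rectangles they agree by the product formula of the
    realization. *)
Lemma noise_independent n (C : set Z) (H : set (Path (X * Z)%type)) :
  measurable C -> measurable H ->
  P ((before_noise n \o W) @^-1` H `&` Zs n @^-1` C) =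
  Q C * P ((before_noise n \o W) @^-1` H).
Proof.
move=> mC mH.
have mbW : measurable_fun setT (before_noise n \o W).
  exact: (measurableT_comp (measurable_before_noise n) mW).
pose c := NngNum (fine_ge0 (measure_ge0 Q C)).
have cE : c%:num%:E = Q C by rewrite /= fineK// fin_num_measure.
rewrite -cE.
suff : image_law (mrestr P (mZC n mC)) mbW H = mscale c (image_law P mbW) H by [].
move: H mH.
apply: (@path_measure_unique _ (X * Z)%type R (@rectangles _ _ X Z)
  (measurable_prod_measurableType X Z) (@rectangles_setI _ _ _ _)
  (@rectangles_setT _ _ _ _)
  (image_law (mrestr P (mZC n mC)) mbW) (mscale c (image_law P mbW))).
  rewrite /image_law/= /mrestr preimage_setT setTI.
  by rewrite (le_lt_trans (probability_le1 _ _)) ?ltry//; exact: mZC.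
move=> B rB _.
pose S := (before_noise n \o W) @^-1` (\bigcap_i (fun y : Path (X * Z)%type => y i) @^-1` B i).
change (P (S `&` Zs n @^-1` C) = c%:num%:E * P S).
have /boolp.choice[A /boolp.choice[D AD]] i :
    exists A, exists D, [/\ measurable A, measurable D & B i = A `*` D].
  by case: (rB i) => A mA [D mD <-]; exists A, D.
have mA i : measurable (A i) by case: (AD i).
have mD i : measurable (D i) by case: (AD i).
have BE i : B i = A i `*` D i by case: (AD i).
(* The erased components equal [point]: if a side of the rectangle excludes [point] there, both
   sides are zero. *)
have [[Dn Bgt]|nkappa] := pselect (D n point /\ forall i, (n < i)%N -> B i point);
    last first.
  rewrite (_ : S = set0) ?set0I ?measure0 ?mule0//.
  apply/seteqP; split => // w Sw; apply: nkappa; split.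
    have := Sw n I; rewrite /= /before_noise ltnn eqxx BE.
    by move=> -[].
  by move=> i ni; have := Sw i I; rewrite /= /before_noise ltnNge ltnW//= gtn_eqF.
pose D' (C : set Z) i := if (i < n)%N then D i else C.
have mD' U : measurable U -> forall i, measurable (D' U i).
  by move=> mU i; rewrite /D'; case: ifP.
have SE U : S `&` Zs n @^-1` U =
    \bigcap_(i in `I_n.+1) (Xs i @^-1` A i `&` Zs i @^-1` D' U i).
  apply/seteqP; split => [w [Sw Uw] i|w Xw].
    rewrite /= ltnS leq_eqVlt => /orP[/eqP ->|iltn].
      rewrite /D' ltnn; split => //.
      by have := Sw n I; rewrite /= /before_noise ltnn eqxx BE => -[].
    have := Sw i I; rewrite /= /before_noise iltn BE => -[Ai Di].
    by rewrite /D' iltn.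
  split; last by have [_] := Xw n (ltnSn n); rewrite /D' ltnn.
  move=> i _; rewrite /= /before_noise; case: ltnP => [iltn|].
    by have := Xw i (leqW iltn); rewrite BE /D' iltn.
  rewrite leq_eqVlt eq_sym => /predU1P[->|ni].
    by rewrite eqxx BE; split => //=; case: (Xw n (ltnSn n)).
  by rewrite gtn_eqF//; exact: Bgt.
have [_ _ _ _ prodE] := real.
(* Writing [S] as its intersection with the sure event on the noise at [n] lets the same formula
   evaluate both sides, which then differ only by the factor at [n]. *)
rewrite SE -[S in RHS]setIT -[setT in RHS](preimage_setT (Zs n)) SE.
rewrite (prodE _ _ _ mA (mD' _ mC)) (prodE _ _ _ mA (mD' _ measurableT)).
rewrite !big_ord_recr/= {2 4}/D' !ltnn probability_setT mule1 fineK ?fin_num_measure//.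
rewrite muleA muleC; congr (_ * (_ * _)).
by apply: eq_bigr => i _; rewrite /D' /= ltn_ord.
Qed.

Lemma obs_measurable : measurable_fun setT (obs h Xs Zs : O -> Path Y).
Proof. exact: (measurableT_comp measurable_obs_path mW). Qed.

(** On a past event [G], the state and the noise at time [n] have a product law by
    [noise_independent]. Integrating out the noise gives [obs_kernel], and the predictor property
    disintegrates the law of the state on [G]. *)
Lemma next_obs_law (Phi : nat -> R.-pker (Path Y) ~> X) :
  is_predictor T Q h rho Phi ->
  forall n (G : set (Path Y)) (B : set Y), cylinder n G -> measurable B ->
  image_law P obs_measurable (G `&` (fun y : Path Y => y n) @^-1` B) =
  \int[image_law P obs_measurable]_(y in G) next_obs (Phi n) y B.
Proof.
move=> [_ predPhi] n G B cG mB; have [mG dG] := cG.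
have mobs := obs_measurable.
have mE : measurable (obs h Xs Zs @^-1` G).
  by rewrite -[X in measurable X]setTI; exact: mobs.
have [mX mZ _ _ _] := real.
pose m : {measure set X -> \bar R} := image_law (mrestr P mE) (mX n).
have moo : m setT < +oo.
  rewrite /m/= /image_law/= /mrestr preimage_setT setTI.
  by rewrite (le_lt_trans (probability_le1 _ _)) ?ltry.
have mXZ : measurable_fun setT (fun w => (Xs n w, Zs n w)).
  exact: measurable_fun_pair.
pose J := image_law (mrestr P mE) mXZ.
have JE A C : measurable A -> measurable C -> J (A `*` C) = finite_mass moo A * Q C.
  move=> mA mC; rewrite /finite_mass /J /m/= /image_law/= /mrestr.
  (* Since [G] reads only the observations before [n], it can be tested on the path after
     [before_noise n]. *)
  pose H : set (Path (X * Z)%type) := (fun u => (u n).1) @^-1` A `&`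
    (trunc n \o obs_path) @^-1` G.
  have mH : measurable H.
    apply: measurableI; rewrite -[X in measurable X]setTI.
      exact: (measurableT_comp measurable_fst (measurable_coord n)).
    exact: (measurableT_comp (measurable_trunc n) measurable_obs_path).
  have HE : Xs n @^-1` A `&` obs h Xs Zs @^-1` G = (before_noise n \o W) @^-1` H.
    rewrite /H preimage_setI; congr (_ `&` _); apply/seteqP.
      by split=> w; rewrite /= /before_noise ltnn eqxx.
    split=> w Gw.
      rewrite /preimage/= (dG _ (obs h Xs Zs w))// => i ni.
      by rewrite /trunc ni /obs_path /before_noise ni.
    rewrite /preimage/= (dG _ ((trunc n \o obs_path) ((before_noise n \o W) w)))// => i ni.
    by rewrite /= /trunc ni /obs_path /before_noise ni.
  rewrite muleC HE -noise_independent// -HE; congr (P _).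
  by apply/seteqP; split => w; rewrite /preimage/=; tauto.
pose H := (fun p : X * Z => h p.1 p.2) @^-1` B.
have mH : measurable H by rewrite -[H]setTI; exact: mh.
rewrite setIC [LHS](_ : _ = J H)//.
transitivity ((finite_mass moo \x Q) H).
  exact/esym/(product_measure_unique JE mH).
transitivity (\int[m]_x obs_kernel x B).
  apply: eq_integral => x _.
  by congr (Q _); apply/seteqP; split => z; rewrite /xsection/= inE.
rewrite (@ge0_integral_compose _ _ _ _ _ (mrestr P mE) (kmap mobs (Phi n)))//; first last.
- exact: measurable_kernel.
- move=> A mA; rewrite [RHS]ge0_integral_mrestr//; last first.
    exact: (measurableT_comp (measurable_kernel (Phi n) _ mA) mobs).
  rewrite -(predPhi _ _ _ _ _ real)//.
  rewrite (@sigma_gen_cylinder _ _ _ Y (obs h Xs Zs)).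
  by exists G.
have mnext : measurable_fun setT (fun y => next_obs (Phi n) y B).
  exact: measurable_kernel.
rewrite ge0_integral_mrestr; [|exact: (measurableT_comp mnext mobs)|].
  2: by move=> w; exact: integral_ge0.
rewrite [RHS]ge0_integral_image_law//.
exact: measurable_funTS.
Qed.

End fixed_realization.

End observation.

(** * Disintegration of a path law along one coordinate *)

Section one_step_disintegration.
Local Open Scope ereal_scope.
Context (R : realType) dY (Y : measurableType dY) (M : probability (Path Y) R)
  (n : nat) (p : R.-pker (Path Y) ~> Y).
Hypothesis stepM : forall (G : set (Path Y)) (B : set Y), cylinder n G ->
  measurable B ->
  M (G `&` (fun y : Path Y => y n) @^-1` B) = \int[M]_(y in G) p y B.

Let K : R.-pker (Path Y) ~> (Path Y) := kbind p (kdirac (measurable_upd n)).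

Let KE y (S : set (Path Y)) : K y S = \int[p y]_x \d_(upd y n x) S.
Proof. by []. Qed.

Lemma cylinder_section (S : set (Path Y)) y : measurable S ->
  measurable [set x | S (upd y n x)].
Proof.
move=> mS; rewrite -[X in measurable X]setTI.
exact: (measurable_comp measurableT _ (measurable_upd n) (pair1_measurable y)).
Qed.

(** Redrawing coordinate [n] from [p] does not change the law of the first [n.+1] coordinates: by
    [stepM] the two truncated laws agree on rectangles. *)
Lemma ge0_integral_step (psi : Path Y -> \bar R) :
  measurable_fun setT psi -> (forall y, 0 <= psi y) -> depends_on_first n.+1 psi ->
  \int[M]_y psi y = \int[M]_y \int[p y]_x psi (upd y n x).
Proof.
move=> mpsi psi0 dpsi.
pose m1 := image_law M (measurable_trunc n.+1).
pose m2 := image_law (mixture M K) (measurable_trunc n.+1).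
have m12 A : measurable A -> m1 A = m2 A.
  apply: (@path_measure_unique _ Y R measurable).
  - by rewrite sigma_algebra_id//; exact: sigma_algebra_measurable.
  - exact: measurableI.
  - exact: measurableT.
  - rewrite /m1 /image_law/= preimage_setT.
    by rewrite (le_lt_trans (probability_le1 _ _)) ?ltry.
  move=> B mB _.
  pose S := trunc n.+1 @^-1` (\bigcap_i (fun y : Path Y => y i) @^-1` B i).
  rewrite [RHS](_ : _ = \int[M]_y K y S); last by [].
  rewrite [LHS](_ : _ = M S); last by [].
  have [Bgt|nBgt] := pselect (forall i, (n < i)%N -> B i point); last first.
    rewrite (_ : S = set0).
      by rewrite measure0 integral0_eq// => y _; rewrite measure0.
    apply/seteqP; split => // w Sw; apply: nBgt => i ni.
    by have := Sw i I; rewrite /= /trunc ltnNge ni.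
  pose G := \bigcap_(i in `I_n) (fun y : Path Y => y i) @^-1` B i.
  have SE y : S y <-> G y /\ B n (y n).
    split=> [Sy|[Gy Bn] i _].
      split; last by have := Sy n I; rewrite /= /trunc ltnSn.
      by move=> i ni; have := Sy i I; rewrite /= /trunc leqW.
    rewrite /= /trunc; case: ltnP => [|ni]; last exact: Bgt.
    by rewrite ltnS leq_eqVlt => /predU1P[->//|ni]; exact: Gy.
  have cG m : cylinder m (\bigcap_(i in `I_m) (fun y : Path Y => y i) @^-1` B i).
    elim: m => [|m ih]; first by rewrite II0 bigcap_set0.
    rewrite bigcap_IIS; apply: cylinderI; first exact: cylinder_coord.
    exact: cylinderW ih.
  rewrite (_ : S = G `&` (fun y : Path Y => y n) @^-1` B n); last first.
    by apply/seteqP; split => y /SE.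
  have GE y x : G (upd y n x) = G y.
    by apply: (cG n).2 => i ni; rewrite /upd ltn_eqF.
  rewrite stepM// [LHS]integral_mkcond; apply: eq_integral => y _.
  rewrite patchE KE.
  rewrite (eq_integral (fun x => (\1_(B n) x)%:E * (\1_G y)%:E)); last first.
    move=> x _; rewrite diracE !indicE -EFinM -natrM mulnb.
    congr ((nat_of_bool _)%:R%:E); apply/idP/andP.
      by rewrite !inE => -[]; rewrite /= /upd eqxx (GE y x) => ? ?; split.
    rewrite !inE => -[Bx Gy]; split; first by rewrite (GE y x).
    by rewrite /= /upd eqxx.
  rewrite ge0_integralZr//; last first.
    by apply/measurable_EFinP; exact: measurable_indic.
  rewrite integral_indic// setIT indicE.
  by case: ifPn => _; rewrite ?mule1 ?mule0.
transitivity (\int[m1]_y psi y).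
  rewrite ge0_integral_image_law// preimage_setT.
  by apply: eq_integral => y _; rewrite depends_trunc.
transitivity (\int[m2]_y psi y).
  by apply: eq_measure_integral => A mA _; exact: m12.
rewrite ge0_integral_image_law// preimage_setT.
transitivity (\int[mixture M K]_y psi y).
  by apply: eq_integral => y _; rewrite depends_trunc.
rewrite integral_mixture//; apply: eq_integral => y _.
rewrite [LHS]integral_kcomp//; apply: eq_integral => x _.
by rewrite [LHS]integral_dirac// diracT mul1e.
Qed.

End one_step_disintegration.

(** * Bounded measurable functions *)

Section bounded_measurable.
Context d (T : measurableType d) (R : realType).
Implicit Types f g : T -> R.

Definition bounded_measurable f :=
  measurable_fun setT f /\ exists C : R, forall x, `|f x| <= C.

Lemma bm_cst r : bounded_measurable (fun=> r).
Proof. by split => //; exists `|r|. Qed.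

Lemma bmD f g : bounded_measurable f -> bounded_measurable g ->
  bounded_measurable (fun x => f x + g x).
Proof.
move=> [mf [C fC]] [mg [C' gC]]; split; first exact: measurable_funD.
by exists (C + C') => x; rewrite (le_trans (ler_normD _ _))// lerD.
Qed.

Lemma bmB f g : bounded_measurable f -> bounded_measurable g ->
  bounded_measurable (fun x => f x - g x).
Proof.
move=> [mf [C fC]] [mg [C' gC]]; split; first exact: measurable_funB.
by exists (C + C') => x; rewrite (le_trans (ler_normB _ _))// lerD.
Qed.

Lemma bmM f g : bounded_measurable f -> bounded_measurable g ->
  bounded_measurable (fun x => f x * g x).
Proof.
move=> [mf [C fC]] [mg [C' gC]]; split; first exact: measurable_funM.
by exists (C * C') => x; rewrite normrM ler_pM.
Qed.

Lemma bm_indic (A : set T) : measurable A -> bounded_measurable (\1_A : T -> R).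
Proof.
move=> mA; split; first exact: measurable_indic.
by exists 1 => x; rewrite indicE normr_nat; case: (_ \in _).
Qed.

Lemma bm_integrable (m : {finite_measure set T -> \bar R}) f :
  bounded_measurable f -> m.-integrable setT (EFin \o f).
Proof.
move=> [mf [C fC]]; apply: measurable_bounded_integrable => //.
  by rewrite -ge0_fin_numE// fin_num_measure.
exists C; split; first exact: num_real.
by move=> x Cx y _; exact: le_trans (fC y) (ltW Cx).
Qed.

End bounded_measurable.

Lemma ge0_Rintegral_eq d d' (T : measurableType d) (T' : measurableType d')
    (R : realType) (m : {measure set T -> \bar R}) (m' : {measure set T' -> \bar R})
    (f : T -> R) (f' : T' -> R) :
  (\int[m]_x (f x)%:E = \int[m']_x (f' x)%:E)%E ->
  Rintegral m setT f = Rintegral m' setT f'.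
Proof. by rewrite /Rintegral => ->. Qed.

(** * Conditional probability of an event given the first coordinates *)

Section conditional_section.
Context (R : realType) dY (Y : measurableType dY) (M : probability (Path Y) R)
  (n : nat) (p : R.-pker (Path Y) ~> Y).

(** For [S] depending on the first [n.+1] coordinates, this is a version of its conditional
    probability given the first [n], as [Rintegral_section] states. *)
Definition section_prob (S : set (Path Y)) (y : Path Y) : R :=
  fine (p y [set x | S (upd y n x)]).

Lemma section_prob_EFin S y : measurable S ->
  (section_prob S y)%:E = p y [set x | S (upd y n x)].
Proof.
move=> mS; rewrite /section_prob fineK// ge0_fin_numE//.
rewrite (le_lt_trans _ (ltry 1))// -[leRHS](@prob_kernel _ _ _ _ _ p y).
by apply: le_measure => //; rewrite inE//; exact: cylinder_section.
Qed.

Lemma section_prob_ge0 S y : 0 <= section_prob S y.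
Proof. exact: fine_ge0. Qed.

Lemma section_prob_le1 S y : measurable S -> section_prob S y <= 1.
Proof.
move=> mS; rewrite -lee_fin section_prob_EFin// -[leRHS](@prob_kernel _ _ _ _ _ p y).
by apply: le_measure => //; rewrite inE//; exact: cylinder_section.
Qed.

Lemma bm_section_prob S : measurable S -> bounded_measurable (section_prob S).
Proof.
move=> mS; split; last first.
  by exists 1 => y; rewrite ger0_norm ?section_prob_ge0// section_prob_le1.
apply/measurable_EFinP.
have := measurable_kernel (kbind p (kdirac (measurable_upd n))) _ mS.
apply: eq_measurable_fun => y _ /=; rewrite section_prob_EFin//.
rewrite /kbind/= /kcomp/= -[X in _ = p y X]setIT -integral_indic//.
exact: cylinder_section.
Qed.

Lemma section_prob_depends S :
  depends_on_first n (fun y => p y : set Y -> \bar R) -> depends_on_first n.+1 S ->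
  depends_on_first n (section_prob S).
Proof.
move=> dp dS y y' yy'; rewrite /section_prob (dp _ _ yy'); congr (fine (_ _)).
apply/funext => x; apply: dS => i; rewrite ltnS leq_eqVlt /upd => /predU1P[->|ni].
  by rewrite eqxx.
by rewrite ltn_eqF// yy'.
Qed.

Hypothesis stepM : forall (G : set (Path Y)) (B : set Y), cylinder n G ->
  measurable B ->
  (M (G `&` (fun y : Path Y => y n) @^-1` B) = \int[M]_(y in G) p y B)%E.

Lemma Rintegral_section (phi : Path Y -> R) (S : set (Path Y)) :
  bounded_measurable phi -> depends_on_first n phi -> cylinder n.+1 S ->
  Rintegral M setT (fun y => phi y * \1_S y) =
  Rintegral M setT (fun y => phi y * section_prob S y).
Proof.
move=> bphi dphi [mS dS].
have ge0_case (f : Path Y -> R) : measurable_fun setT f -> (forall y, 0 <= f y) ->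
    depends_on_first n f ->
    (\int[M]_y (f y * \1_S y)%:E = \int[M]_y (f y * section_prob S y)%:E)%E.
  move=> mf f0 df; rewrite (ge0_integral_step stepM)//; first last.
  - move=> y y' yy'; rewrite (df y y')//; last by move=> i ni; exact: yy' (leqW ni).
    congr (_ * _)%:E; rewrite !indicE; congr ((nat_of_bool _)%:R).
    by apply/idP/idP; rewrite !inE (dS _ _ yy').
  - by move=> y; rewrite lee_fin mulr_ge0// indicE.
  - by apply/measurable_EFinP/measurable_funM => //; exact: measurable_indic.
  apply: eq_integral => y _; rewrite EFinM section_prob_EFin//.
  rewrite (eq_integral (fun x => (f y)%:E * (\1_[set x | S (upd y n x)] x)%:E)%E).
    rewrite ge0_integralZl//; last 2 first.
    - by apply/measurable_EFinP/measurable_indic/cylinder_section.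
    - by rewrite lee_fin.
    by rewrite integral_indic ?setIT//; exact: cylinder_section.
  move=> x _; rewrite -EFinM (df _ y); last by move=> i ni; rewrite /upd ltn_eqF.
  by rewrite !indicE.
have [mphi [C phiC]] := bphi.
have C0 : 0 <= C by rewrite (le_trans _ (phiC point)).
have := ge0_case (fun y => phi y + C).
(* A signed [phi] bounded by [C] is treated as the difference of the nonnegative functions [phi + C]
   and [C]. *)
have := ge0_case (fun=> C).
move=> /(_ (measurable_cst _) (fun=> C0)) /(_ ltac:(by [])) /ge0_Rintegral_eq EC.
have phiC0 y : 0 <= phi y + C.
  by rewrite -lerBlDr sub0r; have := phiC y; rewrite ler_norml => /andP[].
move=> /(_ (measurable_funD mphi (measurable_cst _)) phiC0).
have dphiC : depends_on_first n (fun y => phi y + C).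
  by move=> y y' yy'; rewrite (dphi _ _ yy').
move=> /(_ dphiC) /ge0_Rintegral_eq.
have bS : bounded_measurable (\1_S : Path Y -> R) by exact: bm_indic.
have bp := bm_section_prob mS.
under eq_Rintegral do rewrite mulrDl.
under [X in _ = X -> _]eq_Rintegral do rewrite mulrDl.
rewrite !RintegralD//; try (apply: bm_integrable; do ?[exact: bmM|exact: bm_cst]).
- by rewrite EC => /addIr.
- by apply: bmM => //; exact: bm_cst.
- by apply: bmM => //; exact: bm_cst.
Qed.

End conditional_section.

Lemma measurable_set_ltr d (T : measurableType d) (R : realType) (f g : T -> R) :
  measurable_fun setT f -> measurable_fun setT g -> measurable [set x | f x < g x].
Proof.
move=> /measurable_EFinP mf /measurable_EFinP mg.
by rewrite -[X in measurable X]setTI; exact: (measurable_lte measurableT mf mg).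
Qed.

Lemma measurable_set_ler d (T : measurableType d) (R : realType) (f g : T -> R) :
  measurable_fun setT f -> measurable_fun setT g -> measurable [set x | f x <= g x].
Proof.
move=> /measurable_EFinP mf /measurable_EFinP mg.
by rewrite -[X in measurable X]setTI; exact: (measurable_lee measurableT mf mg).
Qed.

(** * Densities with values in the unit interval *)

Section density.
Context (R : realType).

(* The Radon-Nikodym derivative is only almost everywhere bounded by 1; it is
   truncated so that the density is bounded everywhere. *)
Lemma bounded_density d (T : measurableType d)
    (m l : {finite_measure set T -> \bar R}) :
  (forall A, measurable A -> (m A <= l A)%E) ->
  exists D : T -> R, [/\ measurable_fun setT D, forall x, 0 <= D x <= 1 &
    forall psi : T -> \bar R, measurable_fun setT psi -> (forall x, (0 <= psi x)%E) ->
      (\int[m]_x psi x = \int[l]_x (psi x * (D x)%:E))%E].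
Proof.
move=> ml.
have dom : m `<< l.
  apply/null_content_dominatesP => A mA lA0.
  by apply/eqP; rewrite -measure_le0 -lA0; exact: ml.
pose f := Radon_Nikodym_SigmaFinite.f m l.
have f0 x : (0 <= f x)%E by exact: Radon_Nikodym_SigmaFinite.f_ge0.
have ffin x : f x \is a fin_num by exact: Radon_Nikodym_SigmaFinite.f_fin_num.
have mf : measurable_fun setT f.
  exact: (measurable_int l (Radon_Nikodym_SigmaFinite.f_integrable dom)).
have mff : measurable_fun setT (fine \o f) by exact: (measurableT_comp _ mf).
pose A := [set x | 1 < fine (f x)].
have mA : measurable A.
  by apply: measurable_set_ltr => //; exact: measurable_cst.
have lA0 : l A = 0%E.
  have mg : measurable_fun A (fun x => (fine (f x) - 1)%:E).
    by apply/measurable_EFinP/measurable_funB; [exact: measurable_funTS|exact: measurable_cst].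
  (* On [A] the derivative exceeds [1]. With [m A <= l A] finite, this identity forces the integral
     of the positive excess to be zero, so [A] is null. *)
  have mAE : m A = (\int[l]_(x in A) (fine (f x) - 1)%:E + l A)%E.
    rewrite (Radon_Nikodym_SigmaFinite.f_integral dom mA).
    rewrite (eq_integral (fun x => (fine (f x) - 1)%:E + cst 1 x)%E); last first.
      by move=> x _; rewrite -EFinD subrK fineK.
    rewrite ge0_integralD//.
    - by rewrite integral_cst// mul1e.
    - by move=> x Ax; rewrite lee_fin subr_ge0 ltW.
  have int0 : (\int[l]_(x in A) (fine (f x) - 1)%:E <= 0)%E.
    have lAfin : l A \is a fin_num by exact: fin_num_measure.
    by rewrite -(leeD2rE _ _ lAfin) add0e -mAE; exact: ml.
  have {}int0 : (\int[l]_(x in A) `|(fine (f x) - 1)%:E| = 0)%E.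
    apply/eqP; rewrite eq_le integral_ge0// andbT.
    rewrite (eq_integral (fun x => (fine (f x) - 1)%:E))// => x /[!inE] Ax.
    by rewrite gee0_abs// lee_fin subr_ge0 ltW.
  have /(ae_eq_integral_abs _ mA mg)[N [mN N0 AN]] := int0.
  apply: (subset_measure0 mA mN _ N0) => x Ax; apply: AN => /= /(_ Ax) [].
  by apply/eqP; rewrite gt_eqF// subr_gt0.
exists (fun x => Num.min (fine (f x)) 1); split.
- by apply: measurable_minr => //; exact: measurable_cst.
- move=> x; rewrite ge_min lexx orbT andbT le_min ler01 andbT.
  by rewrite fine_ge0.
move=> psi mpsi psi0.
rewrite -(Radon_Nikodym_SigmaFinite.change_of_variables dom)//.
apply: ae_eq_integral => //.
- exact: emeasurable_funM.
- apply: emeasurable_funM => //; apply/measurable_EFinP.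
  by apply: measurable_minr => //; exact: measurable_cst.
exists A; split => // x; apply: contra_notP => /= /negP.
rewrite -leNgt => fx1 _; congr (_ * _)%E.
by rewrite min_l// fineK.
Qed.

(** The density between the images under [trunc n], composed with [trunc n]: it is the density on
    the sigma-algebra of the first [n] coordinates. *)
Lemma adapted_density dY (Y : measurableType dY)
    (m l : {finite_measure set (Path Y) -> \bar R}) n :
  (forall A, measurable A -> (m A <= l A)%E) ->
  exists D : Path Y -> R, [/\ measurable_fun setT D, forall x, 0 <= D x <= 1,
    depends_on_first n D &
    forall psi : Path Y -> \bar R, measurable_fun setT psi ->
      (forall x, (0 <= psi x)%E) -> depends_on_first n psi ->
      (\int[m]_x psi x = \int[l]_x (psi x * (D x)%:E))%E].
Proof.
move=> ml.
have fin (k : {finite_measure set (Path Y) -> \bar R}) :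
    (image_law k (measurable_trunc n) setT < +oo)%E.
  by rewrite /image_law/= preimage_setT -ge0_fin_numE// fin_num_measure.
have mtr := @measurable_trunc _ Y n.
have [|D [mD D01 DE]] := @bounded_density _ _ (finite_mass (fin m)) (finite_mass (fin l)).
  move=> A mA; apply: ml; rewrite -[X in measurable X]setTI; exact: mtr.
exists (D \o trunc n); split => //.
- exact: measurableT_comp.
- by move=> x; exact: D01.
- exact: (depends_on_first_trunc D).
move=> psi mpsi psi0 dpsi.
transitivity (\int[finite_mass (fin m)]_x psi x)%E.
  rewrite [RHS]ge0_integral_image_law// preimage_setT.
  by apply: eq_integral => x _; rewrite depends_trunc.
rewrite DE// [LHS]ge0_integral_image_law//; last 2 first.
- by apply: emeasurable_funM => //; exact/measurable_EFinP.
- by move=> x _; rewrite mule_ge0// lee_fin; case/andP: (D01 x).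
rewrite preimage_setT; apply: eq_integral => x _.
by rewrite (depends_trunc x dpsi).
Qed.

(** Passes from nonnegative to signed test functions by adding a constant. [adm] stands for a
    restriction on the test functions, such as depending on the first [n] coordinates. *)
Lemma density_bm d (T : measurableType d) (m l : {finite_measure set T -> \bar R})
    (D : T -> R) (adm : set (T -> R)) :
  measurable_fun setT D -> (forall x, 0 <= D x <= 1) ->
  (forall C, adm (cst C)) ->
  (forall psi C, adm psi -> adm (fun x => psi x + C)) ->
  (forall psi : T -> R, measurable_fun setT psi -> (forall x, 0 <= psi x) -> adm psi ->
      (\int[m]_x (psi x)%:E = \int[l]_x ((psi x)%:E * (D x)%:E))%E) ->
  forall psi : T -> R, bounded_measurable psi -> adm psi ->
  Rintegral m setT psi = Rintegral l setT (fun y => psi y * D y).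
Proof.
move=> mD D01 admC admD DE psi bpsi apsi; have [mpsi [C psiC]] := bpsi.
have bD : bounded_measurable D.
  by split => //; exists 1 => x; case/andP: (D01 x) => D0 D1; rewrite ger0_norm.
have ge0_case (f : T -> R) : measurable_fun setT f -> (forall y, 0 <= f y) -> adm f ->
    Rintegral m setT f = Rintegral l setT (fun y => f y * D y).
  by move=> mf f0 af; apply: ge0_Rintegral_eq; rewrite DE.
have C0 : 0 <= C by rewrite (le_trans _ (psiC point)).
have psiC0 y : 0 <= psi y + C.
  by rewrite -lerBlDr sub0r; have := psiC y; rewrite ler_norml => /andP[].
have EC := ge0_case (fun=> C) (measurable_cst _) (fun=> C0) (admC C).
have := ge0_case _ (measurable_funD mpsi (measurable_cst _)) psiC0 (admD _ C apsi).
under [X in _ = X -> _]eq_Rintegral do rewrite mulrDl.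
rewrite !RintegralD//; try (apply: bm_integrable; do ?[exact: bmM|exact: bm_cst]) => //.
- by rewrite EC => /addIr.
- by apply: bmM => //; exact: bm_cst.
Qed.

End density.

(** * The density martingale and its square-summable increments *)

Section merging.
Context (R : realType) dY (Y : measurableType dY) (M N : probability (Path Y) R)
  (p q : nat -> R.-pker (Path Y) ~> Y).
Hypothesis dp : forall n, depends_on_first n (fun y => p n y : set Y -> \bar R).
Hypothesis dq : forall n, depends_on_first n (fun y => q n y : set Y -> \bar R).
Hypothesis stepM : forall n (G : set (Path Y)) (B : set Y), cylinder n G ->
  measurable B ->
  (M (G `&` (fun y : Path Y => y n) @^-1` B) = \int[M]_(y in G) p n y B)%E.
Hypothesis stepN : forall n (G : set (Path Y)) (B : set Y), cylinder n G ->
  measurable B ->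
  (N (G `&` (fun y : Path Y => y n) @^-1` B) = \int[N]_(y in G) q n y B)%E.

Lemma sum_law_fin : (measure_add M N setT < +oo)%E.
Proof.
by rewrite measure_addE lte_add_pinfty// (le_lt_trans (probability_le1 _ _)) ?ltry.
Qed.

Definition sum_law : {finite_measure set (Path Y) -> \bar R} := finite_mass sum_law_fin.

Lemma le_sum_law1 A : (M A <= sum_law A)%E.
Proof. by rewrite [leRHS]measure_addE leeDl. Qed.

Lemma Rintegral_sum_law f : bounded_measurable f ->
  Rintegral sum_law setT f = Rintegral M setT f + Rintegral N setT f.
Proof.
move=> bf; have iM := bm_integrable M bf; have iN := bm_integrable N bf.
rewrite /Rintegral -fineD; [|exact: integrable_fin_num..].
by congr fine; exact: (integral_measure_add measurableT iM iN).
Qed.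

Section martingale.
Variable D : nat -> Path Y -> R.
Hypothesis mD : forall n, measurable_fun setT (D n).
Hypothesis D01 : forall n y, 0 <= D n y <= 1.
Hypothesis dD : forall n, depends_on_first n (D n).
Hypothesis DM : forall n (psi : Path Y -> R), bounded_measurable psi -> depends_on_first n psi ->
  Rintegral M setT psi = Rintegral sum_law setT (fun y => psi y * D n y).

Local Notation E f := (Rintegral sum_law setT f).

Let bD n : bounded_measurable (D n).
Proof.
split; first exact: mD.
by exists 1 => y; case/andP: (D01 n y) => D0 D1; rewrite ger0_norm.
Qed.

Let bD' n : bounded_measurable (fun y => 1 - D n y).
Proof. by apply: bmB => //; exact: bm_cst. Qed.

Let int f : bounded_measurable f -> sum_law.-integrable setT (EFin \o f).
Proof. exact: bm_integrable. Qed.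

Lemma density_compl n (psi : Path Y -> R) : bounded_measurable psi -> depends_on_first n psi ->
  Rintegral N setT psi = E (fun y => psi y * (1 - D n y)).
Proof.
move=> bpsi dpsi; have := Rintegral_sum_law bpsi; rewrite (DM bpsi dpsi).
rewrite (@eq_Rintegral _ _ _ sum_law _ (fun y => psi y - psi y * D n y)
  (fun y => psi y * (1 - D n y))); last by move=> y _; rewrite mulrBr mulr1.
rewrite RintegralB//; [|exact: int|by apply: int; exact: bmM].
by move=> ->; rewrite addrAC subrr add0r.
Qed.

Lemma density_martingale n (psi : Path Y -> R) : bounded_measurable psi -> depends_on_first n psi ->
  E (fun y => psi y * D n.+1 y) = E (fun y => psi y * D n y).
Proof. by move=> bpsi dpsi; rewrite -!DM//; exact: depends_on_firstW dpsi. Qed.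

(** Orthogonality of increments: the martingale property tested against [D n] turns the cross term
    into the mean square of [D n]. *)
Lemma increment_sqr n :
  E (fun y => (D n.+1 y - D n y) ^+ 2) =
  E (fun y => D n.+1 y ^+ 2) - E (fun y => D n y ^+ 2).
Proof.
have b2 m : bounded_measurable (fun y => D m y ^+ 2) by exact: bmM.
have bc : bounded_measurable (fun y => D n y * D n.+1 y) by exact: bmM.
have bcc : bounded_measurable (fun y => 2 * (D n y * D n.+1 y)).
  by apply: bmM => //; exact: bm_cst.
rewrite (@eq_Rintegral _ _ _ _ _
  (fun y => (D n.+1 y ^+ 2 + D n y ^+ 2) - 2 * (D n y * D n.+1 y))); last first.
  by move=> y _; ring.
rewrite RintegralB//; [|by apply: int; exact: bmD|exact: int].
rewrite RintegralD//; [|exact: int..].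
rewrite RintegralZl//; [|exact: int].
rewrite (density_martingale (bD n) (@dD n)).
rewrite (_ : E (fun y => D n y * D n y) = E (fun y => D n y ^+ 2))//.
ring.
Qed.

Variable S : nat -> set (Path Y).
Hypothesis cS : forall n, cylinder n.+1 (S n).

Definition weighted_gap n y := D n y * (1 - D n y) *
  (section_prob n (p n) (S n) y - section_prob n (q n) (S n) y).

Let mS n : measurable (S n). Proof. by case: (cS n). Qed.
Let dS n : depends_on_first n.+1 (S n). Proof. by case: (cS n). Qed.

Let bpS n : bounded_measurable (section_prob n (p n) (S n)).
Proof. exact: bm_section_prob. Qed.

Let bqS n : bounded_measurable (section_prob n (q n) (S n)).
Proof. exact: bm_section_prob. Qed.

Let bS n : bounded_measurable (\1_(S n) : Path Y -> R).
Proof. exact: bm_indic. Qed.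

Let dS1 n : depends_on_first n.+1 (\1_(S n) : Path Y -> R).
Proof.
move=> y y' yy'; rewrite !indicE; congr ((nat_of_bool _)%:R).
by apply/idP/idP; rewrite !inE (dS yy').
Qed.

Let bgap n : bounded_measurable (weighted_gap n).
Proof. by apply: bmM; [exact: bmM|exact: bmB]. Qed.

Let dgap n : depends_on_first n (weighted_gap n).
Proof.
move=> y y' yy'; rewrite /weighted_gap (dD yy').
by rewrite (section_prob_depends (dp (n:=n)) (dS (n:=n)) yy')
  (section_prob_depends (dq (n:=n)) (dS (n:=n)) yy').
Qed.

(** The [p] term carries the density [D n] of [M], the [q] term the density [1 - D n] of [N]. Under
    each law the section probability becomes the indicator of [S n], integrated with the densities
    at [n.+1]. Then [(1 - D n) * D n.+1 - D n * (1 - D n.+1)] is the increment. *)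
Lemma weighted_gapE n (phi : Path Y -> R) : bounded_measurable phi -> depends_on_first n phi ->
  E (fun y => phi y * weighted_gap n y) =
  E (fun y => phi y * (D n.+1 y - D n y) * \1_(S n) y).
Proof.
move=> bphi dphi.
pose phi1 y := phi y * (1 - D n y); pose phi2 y := phi y * D n y.
have b1 : bounded_measurable phi1 by exact: bmM.
have b2 : bounded_measurable phi2 by exact: bmM.
have d1 : depends_on_first n phi1 by move=> y y' yy'; rewrite /phi1 (dphi _ _ yy') (dD yy').
have d2 : depends_on_first n phi2 by move=> y y' yy'; rewrite /phi2 (dphi _ _ yy') (dD yy').
have dmul (f g : Path Y -> R) m : depends_on_first m f -> depends_on_first m g ->
    depends_on_first m (fun y => f y * g y).
  by move=> df dg y y' yy'; rewrite (df _ _ yy') (dg _ _ yy').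
have EM : E (fun y => phi1 y * section_prob n (p n) (S n) y * D n y) =
    E (fun y => phi1 y * \1_(S n) y * D n.+1 y).
  rewrite -DM; [|exact: bmM|]; last first.
    by apply: dmul => //; exact: section_prob_depends.
  rewrite -DM; [|exact: bmM|]; last first.
    by apply: dmul => //; exact: depends_on_firstW d1.
  by rewrite (Rintegral_section (stepM (n:=n))).
have EN : E (fun y => phi2 y * section_prob n (q n) (S n) y * (1 - D n y)) =
    E (fun y => phi2 y * \1_(S n) y * (1 - D n.+1 y)).
  rewrite -density_compl; [|exact: bmM|]; last first.
    by apply: dmul => //; exact: section_prob_depends.
  rewrite -density_compl; [|exact: bmM|]; last first.
    by apply: dmul => //; exact: depends_on_firstW d2.
  by rewrite (Rintegral_section (stepN (n:=n))).
rewrite (@eq_Rintegral _ _ _ _ _ (fun y =>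
  phi1 y * section_prob n (p n) (S n) y * D n y -
  phi2 y * section_prob n (q n) (S n) y * (1 - D n y))); last first.
  by move=> y _; rewrite /weighted_gap /phi1 /phi2; ring.
rewrite RintegralB//; [|by apply: int; do 2 apply: bmM => //..].
rewrite EM EN -RintegralB//; [|by apply: int; do 2 apply: bmM => //..].
by apply: eq_Rintegral => y _; rewrite /phi1 /phi2; ring.
Qed.

(** [weighted_gapE] is tested against the gap itself; in [a * b <= (a^2 + b^2) / 2] the half with
    [a^2] is then absorbed on the left. *)
Lemma weighted_gap_sqr n :
  E (fun y => weighted_gap n y ^+ 2) <= E (fun y => (D n.+1 y - D n y) ^+ 2).
Proof.
have bA2 : bounded_measurable (fun y => weighted_gap n y ^+ 2) by exact: bmM.
have bI2 : bounded_measurable (fun y => (D n.+1 y - D n y) ^+ 2).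
  by apply: bmM; exact: bmB.
have bh f : bounded_measurable f -> bounded_measurable (fun y => 2^-1 * f y).
  by move=> bf; apply: bmM => //; exact: bm_cst.
have : E (fun y => weighted_gap n y ^+ 2) <=
    E (fun y => 2^-1 * weighted_gap n y ^+ 2 + 2^-1 * (D n.+1 y - D n y) ^+ 2).
  rewrite [leLHS](weighted_gapE (@bgap n) (@dgap n)); apply: le_Rintegral => //.
  - by apply: int; apply: bmM => //; apply: bmM => //; exact: bmB.
  - by apply: int; apply: bmD; exact: bh.
  move=> y _; rewrite indicE.
  set a := weighted_gap n y; set b := D n.+1 y - D n y.
  have ab := sqr_ge0 (a - b); have a2 := sqr_ge0 a; have b2 := sqr_ge0 b.
  case: (_ \in _); rewrite ?mulr1 ?mulr0; last by nra.
  by rewrite sqrrB -mulr_natr in ab; nra.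
rewrite RintegralD//; [|by apply: int; exact: bh..].
rewrite !RintegralZl//; [|exact: int..].
by move=> ?; lra.
Qed.

Lemma weighted_gap_sum k :
  \sum_(0 <= i < k) E (fun y => weighted_gap i y ^+ 2) <= E (fun=> 1).
Proof.
have b2 m : bounded_measurable (fun y => D m y ^+ 2) by exact: bmM.
have le1 m : E (fun y => D m y ^+ 2) <= E (fun=> 1).
  apply: le_Rintegral => //; [exact: int|by apply: int; exact: bm_cst|].
  by move=> y _; case/andP: (D01 m y) => D0 D1; rewrite expr_le1.
apply: le_trans (le1 k).
elim: k => [|k ih]; first by rewrite big_geq// Rintegral_ge0// => y _; exact: sqr_ge0.
rewrite big_nat_recr//= (le_trans (lerD ih (weighted_gap_sqr k)))//.
by rewrite increment_sqr addrC subrK.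
Qed.

(** The sum of the squares is integrable, hence finite almost everywhere; each square is at most the
    tail starting at it. *)
Lemma weighted_gap_cvg0 : {ae sum_law, forall y, forall e : R, 0 < e ->
  exists m, forall n, (m <= n)%N -> `|weighted_gap n y| <= e}.
Proof.
have mA2 n : measurable_fun setT (fun y => (weighted_gap n y ^+ 2)%:E).
  by apply/measurable_EFinP/measurable_funX; case: (@bgap n).
have A20 n y : (0 <= (weighted_gap n y ^+ 2)%:E)%E by rewrite lee_fin sqr_ge0.
have intfin : (\int[sum_law]_y (\sum_(n <oo) (weighted_gap n y ^+ 2)%:E) < +oo)%E.
  rewrite integral_nneseries//.
  apply: (@le_lt_trans _ _ (E (fun=> 1))%:E); last exact: ltry.
  apply: lime_le; first by apply: is_cvg_nneseries => n _ _; exact: integral_ge0.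
  apply: nearW => k.
  rewrite (eq_bigr (fun n => (E (fun y => weighted_gap n y ^+ 2))%:E)).
    by rewrite sumEFin lee_fin weighted_gap_sum.
  move=> n _; rewrite fineK//; apply: integrable_fin_num => //.
  by apply: int; exact: bmM.
have isum : sum_law.-integrable setT (fun y => \sum_(n <oo) (weighted_gap n y ^+ 2)%:E)%E.
  apply/integrableP; split; first exact: ge0_emeasurable_sum.
  by under eq_integral do rewrite gee0_abs ?nneseries_ge0//.
have := integrable_ae measurableT isum.
apply: filterS => y /(_ I) yfin e e0.
have yoo : (\sum_(n <oo) (weighted_gap n y ^+ 2)%:E < +oo)%E by rewrite ltey_eq yfin.
have := nneseries_tail_cvg yoo (fun k _ => A20 k y).
move=> /fine_cvgP[tailfin] /cvgrPdist_le /(_ (e ^+ 2)).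
rewrite exprn_gt0// => /(_ isT) tailcvg.
have : \forall n \near \oo, `|weighted_gap n y| <= e.
  near=> n.
  have tn : (\sum_(n <= k <oo) (weighted_gap k y ^+ 2)%:E)%E \is a fin_num.
    by near: n; exact: tailfin.
  have tne : `|0 - fine (\sum_(n <= k <oo) (weighted_gap k y ^+ 2)%:E)%E| <= e ^+ 2.
    by near: n; exact: tailcvg.
  have := @nneseries_lim_ge _ (fun k => (weighted_gap k y ^+ 2)%:E) xpredT n n.+1
    (fun k _ _ => A20 k y).
  rewrite big_nat1 -(fineK tn) lee_fin => An.
  rewrite -(ler_sqr (normr_ge0 _) (ltW e0)) real_normK ?num_real//.
  apply: le_trans An _; apply: le_trans tne.
  by rewrite sub0r normrN ler_norm.
by move=> [m _ mA]; exists m => n mn; exact: mA.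
Unshelve. all: by end_near. Qed.

End martingale.

End merging.

Lemma ae_of_le d (T : measurableType d) (R : realType)
    (m l : {measure set T -> \bar R}) (Pr : T -> Prop) :
  (forall A, measurable A -> l A = 0%E -> m A = 0%E) ->
  {ae l, forall x, Pr x} -> {ae m, forall x, Pr x}.
Proof. by move=> ml [A [mA lA0 PA]]; exists A; split => //; exact: ml. Qed.

(* Doob's maximal inequality applied to the first time the density is at most
   [c]. *)
Lemma density_bounded_below (R : realType) dY (Y : measurableType dY)
    (m l : {finite_measure set (Path Y) -> \bar R}) (D : nat -> Path Y -> R) :
  (forall n, measurable_fun setT (D n)) -> (forall n y, 0 <= D n y <= 1) ->
  (forall n, depends_on_first n (D n)) ->
  (forall n (psi : Path Y -> R), bounded_measurable psi -> depends_on_first n psi ->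
    Rintegral m setT psi = Rintegral l setT (fun y => psi y * D n y)) ->
  {ae m, forall y, exists2 c : R, 0 < c & forall n, c <= D n y}.
Proof.
move=> mD D01 dD DM.
pose G c n := [set y | D n y <= c] `&` \bigcap_(i in `I_n) [set y | c < D i y].
have cG c n : cylinder n (G c n).
  apply: cylinderI.
    split; last by move=> y y' yy'; rewrite /mkset (dD _ _ _ yy').
    by apply: measurable_set_ler => //; exact: measurable_cst.
  split.
    apply: bigcap_measurableType => i _.
    by apply: measurable_set_ltr => //; exact: measurable_cst.
  move=> y y' yy'; apply/propext; split=> yD i /= ni; have := yD i ni => /=.
    by rewrite (dD i y y')// => j ji; apply: yy'; exact: ltn_trans ni.
  by rewrite (dD i y y')// => j ji; apply: yy'; exact: ltn_trans ni.
have mG c n : measurable (G c n) by case: (cG c n).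
(* [G c n] says that [n] is the first time with density at most [c]. It is decided by the first [n]
   coordinates, so [D n] can be used as the density on it. *)
have GE c : 0 < c -> forall n, (m (G c n) <= c%:E * l (G c n))%E.
  move=> c0 n.
  have bG : bounded_measurable (\1_(G c n) : Path Y -> R) by exact: bm_indic.
  have bD : bounded_measurable (D n).
    by split => //; exists 1 => y; case/andP: (D01 n y) => D0 D1; rewrite ger0_norm.
  have dG : depends_on_first n (\1_(G c n) : Path Y -> R).
    move=> y y' yy'; rewrite !indicE; congr ((nat_of_bool _)%:R).
    by apply/idP/idP; rewrite !inE ((cG c n).2 _ _ yy').
  have fineE (k : {finite_measure set (Path Y) -> \bar R}) :
      k (G c n) = (Rintegral k setT (\1_(G c n)))%:E.
    by rewrite /Rintegral integral_indic// setIT fineK// fin_num_measure.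
  rewrite !fineE -EFinM lee_fin (DM n)// -RintegralZl//; last exact: bm_integrable.
  apply: le_Rintegral => //.
  - by apply: bm_integrable; exact: bmM.
  - by apply: bm_integrable; apply: bmM => //; exact: bm_cst.
  move=> y _; rewrite indicE; case: (boolP (y \in _)) => [|_]; last by rewrite mul0r mulr0.
  by rewrite inE => -[yc _]; rewrite mul1r mulr1.
pose F c := \bigcup_n G c n.
have mF c : measurable (F c) by exact: bigcupT_measurable.
have tG c : trivIset setT (G c).
  apply/trivIsetP => i j _ _; wlog ij : i j / (i < j)%N => [wl|_].
    by rewrite neq_ltn => /orP[|] h; [|rewrite setIC]; apply: wl; rewrite // ltn_eqF.
  rewrite -subset0 => y [[yi _] [_ /(_ i ij)]] /=.
  by rewrite ltNge => /negP.
have mFc c : 0 < c -> (m (F c) <= c%:E * l setT)%E.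
  move=> c0; apply: (@le_trans _ _ (c%:E * l (F c))%E); last first.
    apply: lee_wpmul2l; first by rewrite lee_fin ltW.
    by apply: le_measure; rewrite ?inE.
  rewrite measure_bigcup// [X in (_ <= _ * X)%E]measure_bigcup//.
  rewrite -nneseriesZl//; apply: lee_nneseries => // n _; exact: GE.
exists (\bigcap_k F k.+1%:R^-1); split.
- exact: bigcap_measurableType.
- apply/eqP; rewrite -measure_le0; apply/lee_addgt0Pr => e e0; rewrite add0e.
  have lT0 : (0 <= fine (l setT)) by exact: fine_ge0.
  (* Chosen so that [l setT / k.+1 <= e]. *)
  pose k := Num.truncn ((fine (l setT) + 1) / e).
  have k0 : 0 < k.+1%:R^-1 :> R by rewrite invr_gt0.
  apply: (@le_trans _ _ (m (F k.+1%:R^-1))).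
    by apply: le_measure; rewrite ?inE//; [exact: bigcap_measurableType|exact: bigcap_inf].
  apply: le_trans (mFc _ k0) _.
  rewrite -[l setT]fineK ?fin_num_measure// -EFinM lee_fin.
  rewrite mulrC ler_pdivrMr// mulrC -ler_pdivrMr//.
  apply: le_trans (ltW (truncnS_gt _)).
  by rewrite ler_pM2r ?invr_gt0// lerDl.
move=> y /= nex k _; apply: contrapT => nF; apply: nex.
exists k.+1%:R^-1; first by rewrite invr_gt0.
move=> n; rewrite leNgt; apply/negP => Dn; apply: nF.
have exn : exists n, D n y <= k.+1%:R^-1 by exists n; exact: ltW.
case: (ex_minnP exn) => j yj minj; exists j => //; split => // i /= ij.
by rewrite ltNge; apply/negP => /minj; rewrite leqNgt ij.
Qed.

(** * Uniform merging over a countable family of events *)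

Section merging_theorem.
Context (R : realType) dY (Y : measurableType dY) (M N : probability (Path Y) R)
  (p q : nat -> R.-pker (Path Y) ~> Y).
Hypothesis dp : forall n, depends_on_first n (fun y => p n y : set Y -> \bar R).
Hypothesis dq : forall n, depends_on_first n (fun y => q n y : set Y -> \bar R).
Hypothesis stepM : forall n (G : set (Path Y)) (B : set Y), cylinder n G ->
  measurable B ->
  (M (G `&` (fun y : Path Y => y n) @^-1` B) = \int[M]_(y in G) p n y B)%E.
Hypothesis stepN : forall n (G : set (Path Y)) (B : set Y), cylinder n G ->
  measurable B ->
  (N (G `&` (fun y : Path Y => y n) @^-1` B) = \int[N]_(y in G) q n y B)%E.
Hypothesis MN : forall A, measurable A -> N A = 0%E -> M A = 0%E.
Variable B : nat -> set Y.
Hypothesis mB : forall j, measurable (B j).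

Let gap n j y := `|fine (p n y (B j)) - fine (q n y (B j))|.

Let first_gap e n j : set (Path Y) :=
  [set y | e < gap n j y] `&` \bigcap_(i in `I_j) [set y | gap n i y <= e].

(** Observation [n] is asked to fall in the first [B j] whose two predicted probabilities differ by
    more than [e]. That index is known from the past, so the section of this event at a path is the
    corresponding [B j]. *)
Let gap_set e n : set (Path Y) :=
  \bigcup_j (first_gap e n j `&` (fun y : Path Y => y n) @^-1` B j).

Let measurable_gap n j : measurable_fun setT (gap n j).
Proof.
apply: measurableT_comp => //; apply: measurable_funB.
  by apply: measurableT_comp => //; exact: measurable_kernel.
by apply: measurableT_comp => //; exact: measurable_kernel.
Qed.

Let gap_depends n j : depends_on_first n (gap n j).
Proof. by move=> y y' yy'; rewrite /gap (dp yy') (dq yy'). Qed.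

Let first_gap_cylinder e n j : cylinder n (first_gap e n j).
Proof.
split.
  apply: measurableI.
    by apply: measurable_set_ltr => //; exact: measurable_cst.
  apply: bigcap_measurableType => i _.
  by apply: measurable_set_ler => //; exact: measurable_cst.
move=> y y' yy'; apply/propext; rewrite /first_gap /=; split=> -[yj yi]; split.
- by rewrite /= -(gap_depends _ yy').
- by move=> i ij; have := yi i ij; rewrite /= (gap_depends _ yy').
- by rewrite /= (gap_depends _ yy').
- by move=> i ij; have := yi i ij; rewrite /= (gap_depends _ yy').
Qed.

Let gap_set_cylinder e n : cylinder n.+1 (gap_set e n).
Proof.
have cj j : cylinder n.+1 (first_gap e n j `&` (fun y : Path Y => y n) @^-1` B j).
  by apply: cylinderI; [exact: cylinderW (first_gap_cylinder e n j)|exact: cylinder_coord].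
split; first by apply: bigcupT_measurable => j; case: (cj j).
move=> y y' yy'; apply/propext; split=> -[j _ yj]; exists j => //.
  by rewrite -((cj j).2 _ _ yy').
by rewrite ((cj j).2 _ _ yy').
Qed.

Let first_gap_section e n j y : first_gap e n j y ->
  [set x | gap_set e n (upd y n x)] = B j.
Proof.
move=> yj; have updE x i : first_gap e n i (upd y n x) = first_gap e n i y.
  by apply: (first_gap_cylinder e n i).2 => k kn; rewrite /upd ltn_eqF.
apply/seteqP; split => [x /= [i _]|x Bx].
  rewrite /= /setI /mkset updE => -[yi]; rewrite /preimage /= /upd eqxx.
  suff -> : i = j by [].
  have [ij|ji|//] := ltngtP i j.
    by case: yi => + _; case: yj => _ /(_ i ij); rewrite /= leNgt => /negP.
  by case: yj => + _; case: yi => _ /(_ j ji); rewrite /= leNgt => /negP.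
by exists j => //; split; [rewrite updE|rewrite /preimage /= /upd eqxx].
Qed.

Theorem one_step_merging : {ae M, forall y, forall e : R, 0 < e ->
  exists m, forall n, (m <= n)%N -> forall j,
    `|fine (p n y (B j)) - fine (q n y (B j))| <= e}.
Proof.
have /boolp.choice[D Dprop] n :=
  @adapted_density R _ Y M (sum_law M N) n (fun A _ => le_sum_law1 M N A).
have mD n : measurable_fun setT (D n) by case: (Dprop n).
have D01 n y : 0 <= D n y <= 1 by case: (Dprop n).
have dD n : depends_on_first n (D n) by case: (Dprop n).
have DM n (psi : Path Y -> R) : bounded_measurable psi -> depends_on_first n psi ->
    Rintegral M setT psi = Rintegral (sum_law M N) setT (fun y => psi y * D n y).
  case: (Dprop n) => _ _ _ DE.
  apply: (@density_bm R _ (Path Y) M (sum_law M N) (D n) (fun f => depends_on_first n f)) => //.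
    by move=> f C df y y' yy'; rewrite (df _ _ yy').
  move=> f mf f0 df; apply: DE => //; first exact/measurable_EFinP.
  by move=> y y' yy'; rewrite (df _ _ yy').
have lM A : measurable A -> sum_law M N A = 0%E -> M A = 0%E.
  by move=> mA lA; apply/eqP; rewrite -measure_le0 -lA; exact: le_sum_law1.
have Dlow := density_bounded_below mD D01 dD DM.
have D'low : {ae M, forall y, exists2 c : R, 0 < c & forall n, c <= 1 - D n y}.
  (* The bound for [1 - D n], the density of [N], holds [N]-a.s.; absolute continuity makes it
     [M]-a.s. *)
  apply: (ae_of_le MN); apply: (@density_bounded_below _ _ _ N (sum_law M N)
    (fun n y => 1 - D n y)).
  - by move=> n; apply: measurable_funB => //; exact: measurable_cst.
  - by move=> n y; have := D01 n y; lra.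
  - by move=> n y y' yy'; rewrite (dD _ _ _ yy').
  - by move=> n psi; exact: density_compl.
(* The tested event depends on the threshold, so countably many thresholds are used to keep a single
   null set. *)
have gapcvg : {ae M, forall y, forall k : nat, forall e : R, 0 < e -> exists m,
    forall n, (m <= n)%N -> `|weighted_gap p q D (gap_set k.+1%:R^-1) n y| <= e}.
  apply/ae_foralln => k; apply: (ae_of_le lM).
  exact: weighted_gap_cvg0.
apply: filterS3 Dlow D'low gapcvg => y [c c0 cD] [c' c0' cD'] gapy e e0.
pose k := Num.truncn e^-1; pose ek : R := k.+1%:R^-1.
have ek0 : 0 < ek by rewrite invr_gt0.
have eke : ek <= e.
  by rewrite /ek -[leRHS]invrK lef_pV2 ?posrE ?invr_gt0//; exact/ltW/truncnS_gt.
(* A gap above [ek] would make the weighted gap at least [c * c' * ek]; the factor one half makes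
   the contradiction strict. *)
have cce0 : 0 < c * c' * ek / 2 by rewrite divr_gt0// mulr_gt0// mulr_gt0.
have [m mgap] := gapy k _ cce0; exists m => n mn j.
apply: le_trans eke; rewrite leNgt; apply/negP => ekj.
have exj : exists j, ek < gap n j y by exists j.
have {ekj}[i yi] : exists i, first_gap ek n i y.
  case: (ex_minnP exj) => i yi mini; exists i; split => // l /= li.
  by rewrite leNgt; apply/negP => /mini; rewrite leqNgt li.
have := mgap n mn; rewrite /weighted_gap /section_prob -/ek (first_gap_section yi).
rewrite !normrM -/(gap n i y) (ger0_norm (_ : 0 <= D n y)); last by case/andP: (D01 n y).
rewrite ger0_norm; last by have := D01 n y; lra.
case: yi => /= yi _; apply/negP; rewrite -ltNge.
apply: (@lt_le_trans _ _ (c * c' * ek)).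
  by rewrite ltr_pdivrMr// ltr_pMr ?ltr1n// mulr_gt0// mulr_gt0.
apply: ler_pM; [by rewrite mulr_ge0 ?ltW|exact: ltW| |exact: ltW].
by apply: ler_pM; [exact: ltW|exact: ltW|exact: cD|exact: cD'].
Qed.

End merging_theorem.

(** * From an algebra to all events, then to bounded functions *)

Section total_variation.
Context d (T : measurableType d) (R : realType) (p q : probability T R) (e : R).

(** Monotone class argument: the bound passes to monotone limits by continuity of finite measures,
    and the generated sigma-ring is a sigma-algebra because [G] contains the whole space. *)
Lemma gap_on_algebra (G : set (set T)) : setring G -> G setT ->
  @measurable _ T = <<s G >> ->
  (forall B, G B -> `|fine (p B) - fine (q B)| <= e) ->
  forall B, measurable B -> `|fine (p B) - fine (q B)| <= e.
Proof.
move=> ringG GT GE Ge.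
pose C := [set B | measurable B /\ `|fine (p B) - fine (q B)| <= e].
have limC F B : measurable B -> (forall n, C (F n)) ->
    (p \o F @ \oo --> p B)%E -> (q \o F @ \oo --> q B)%E -> C B.
  move=> mB CF pF qF; split => //.
  have fineF (r : probability T R) : (r \o F @ \oo --> r B)%E ->
      (fun n => fine (r (F n))) @ \oo --> fine (r B).
    move=> rF; apply: (@fine_cvg _ _ _ _ (r \o F)).
    by rewrite fineK ?fin_num_measure.
  have cvgd : (fun n => `|fine (p (F n)) - fine (q (F n))|) @ \oo -->
      `|fine (p B) - fine (q B)|.
    by apply: cvg_norm; apply: cvgB; exact: fineF.
  apply: (cvgr_to_le cvgd); apply: nearW => n.
  by case: (CF n).
have monC : monotone C.
  split=> F mF CF; have mFn n : measurable (F n) by case: (CF n).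
    have mU : measurable (\bigcup_n F n) by exact: bigcupT_measurable.
    by apply: (limC F) => //; apply: nondecreasing_cvg_mu.
  have mI : measurable (\bigcap_n F n) by exact: bigcap_measurableType.
  apply: (limC F) => //; apply: nonincreasing_cvg_mu => //.
    by rewrite -ge0_fin_numE// fin_num_measure.
  by rewrite -ge0_fin_numE// fin_num_measure.
have sr : sigma_algebra setT <<sr G>>.
  have [sr0 srD srU] := smallest_sigma_ring G; split => // A sA.
  by apply: srD => //; exact: sub_g_sigma_ring.
suff : measurable `<=` C by move=> mC B /mC[].
rewrite GE; apply: (@subset_trans _ <<sr G>>).
  by apply: smallest_sub => //; exact: sub_g_sigma_ring.
rewrite -g_monotone_g_sigma_ring//; apply: smallest_sub => // B GB.
by split; [rewrite GE; exact: sub_sigma_algebra|exact: Ge].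
Qed.

Hypothesis gap : forall B, measurable B -> `|fine (p B) - fine (q B)| <= e.

(** With [D] the density of [p] relative to [p + q], the difference of the laws has density
    [2 * D - 1]. Its sign is given by the Hahn set [A] where [D] is at least one half, and [gap] on
    [A] and its complement bounds its absolute integral by [2 * e]. *)
Lemma gap_Rintegral (g : T -> R) (C : R) : measurable_fun setT g ->
  (forall x, `|g x| <= C) ->
  `|Rintegral p setT g - Rintegral q setT g| <= 2 * C * e.
Proof.
move=> mg gC.
have pq_fin : (measure_add p q setT < +oo)%E.
  by rewrite measure_addE lte_add_pinfty// (le_lt_trans (probability_le1 _ _)) ?ltry.
pose l : {finite_measure set T -> \bar R} := finite_mass pq_fin.
have ple A : measurable A -> (p A <= l A)%E.
  by move=> _; rewrite [leRHS]measure_addE leeDl.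
have [D [mD D01 DE]] := bounded_density ple.
have bD : bounded_measurable D.
  by split => //; exists 1 => x; case/andP: (D01 x) => D0 D1; rewrite ger0_norm.
have pE psi : bounded_measurable psi ->
    Rintegral p setT psi = Rintegral l setT (fun x => psi x * D x).
  move=> bpsi; apply: (@density_bm _ _ _ p l D setT) => // f mf f0 _.
  rewrite DE//; [exact/measurable_EFinP].
have lE psi : bounded_measurable psi ->
    Rintegral l setT psi = Rintegral p setT psi + Rintegral q setT psi.
  move=> bpsi; have ip := bm_integrable p bpsi; have iq := bm_integrable q bpsi.
  rewrite /Rintegral -fineD; [|exact: integrable_fin_num..].
  by congr fine; exact: (integral_measure_add measurableT ip iq).
have C0 : 0 <= C by rewrite (le_trans _ (gC point)).
pose A := [set x | 2^-1 <= D x].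
have mA : measurable A by apply: measurable_set_ler => //; exact: measurable_cst.
have bg : bounded_measurable g by split => //; exists C.
have b1 := bm_cst T (1 : R).
have bA : bounded_measurable (\1_A : T -> R) by exact: bm_indic.
have bAc : bounded_measurable (\1_(~` A) : T -> R).
  by apply: bm_indic; exact: measurableC.
have diffE psi : bounded_measurable psi -> Rintegral p setT psi - Rintegral q setT psi =
    Rintegral l setT (fun x => psi x * (2 * D x - 1)).
  move=> bpsi; have lpsi := lE _ bpsi.
  rewrite [RHS](@eq_Rintegral _ _ _ _ _ (fun x => 2 * (psi x * D x) - psi x)); last first.
    by move=> x _; ring.
  have bpD : bounded_measurable (fun x => psi x * D x) by exact: bmM.
  rewrite RintegralB//; last 2 first.
  - by apply: bm_integrable; apply: bmM => //; exact: bm_cst.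
  - exact: bm_integrable.
  rewrite RintegralZl//; last exact: bm_integrable.
  by rewrite -pE// lpsi; ring.
have indE (r : probability T R) U : measurable U ->
    Rintegral r setT (\1_U) = fine (r U).
  by move=> mU; rewrite /Rintegral integral_indic// setIT.
have b2D : bounded_measurable (fun x => 2 * D x - 1).
  by apply: bmB => //; apply: bmM => //; exact: bm_cst.
have bigE : Rintegral l setT (fun x => \1_A x * (2 * D x - 1)) -
    Rintegral l setT (fun x => \1_(~` A) x * (2 * D x - 1)) <= 2 * e.
  have mAc := measurableC mA.
  rewrite -!diffE// !indE//.
  have := gap mA; have := gap mAc.
  rewrite !ler_norml => /andP[? ?] /andP[? ?]; lra.
rewrite diffE//; apply: le_trans (le_normr_Rintegral _ _) _ => //.
  by apply: bm_integrable; exact: bmM.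
have bAD : bounded_measurable (fun x => \1_A x * (2 * D x - 1)) by exact: bmM.
have bAcD : bounded_measurable (fun x => \1_(~` A) x * (2 * D x - 1)) by exact: bmM.
apply: (@le_trans _ _ (Rintegral l setT (fun x =>
    C * (\1_A x * (2 * D x - 1) - \1_(~` A) x * (2 * D x - 1))))).
  apply: le_Rintegral => //.
  - by apply: integrable_norm; apply: bm_integrable; exact: bmM.
  - by apply: bm_integrable; apply: bmM; [exact: bm_cst|exact: bmB].
  move=> x _; rewrite normrM; apply: ler_pM => //.
  rewrite !indicE in_setC; case: (boolP (x \in A)) => xA /=.
    rewrite mul1r mul0r subr0 ger0_norm//.
    by move: xA; rewrite inE /A /= => xA; lra.
  rewrite mul0r mul1r sub0r ler0_norm//.
  by move: xA; rewrite notin_setE /A /= => /negP; rewrite -ltNge => xA; lra.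
rewrite RintegralZl//; last by apply: bm_integrable; exact: bmB.
rewrite RintegralB//; [|exact: bm_integrable..].
by rewrite -mulrA mulrCA ler_wpM2l.
Qed.

End total_variation.

(** * A countable algebra generating the Borel sets of a Polish space *)

Section countable_algebra.
Context (R : realType) (Y : completePseudoMetricType R) (hY : polish Y).

(** The sets are the values of finite Boolean expressions over a countable base; such expressions
    are trees with countable labels, hence enumerable. *)
Lemma polish_countable_algebra : exists B : nat -> set (Borel Y),
  [/\ forall j, measurable (B j), setring (range B), range B setT &
      @measurable _ (Borel Y) = <<s range B >>].
Proof.
case: hY => _ [D [/countable_injP[f injf] denseD]].
pose c n : Y := xget point [set x | D x /\ f x = n].
have cP x : D x -> c (f x) = x.
  move=> Dx; rewrite /c; case: xgetP => [y _ [Dy fyx]|/(_ x) []//].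
  by apply: injf; rewrite ?inE.
(* Balls need not be open, so the base consists of interiors of balls. *)
pose base (ik : nat * nat) : set Y := (ball (c ik.1) (ik.2.+1%:R^-1 : R))^°.
pose fix eval (t : GenTree.tree (nat * nat)%type) : set Y :=
  match t with
  | GenTree.Leaf ik => base ik
  | GenTree.Node 0 [:: t] => ~` eval t
  | GenTree.Node _ [:: t; u] => eval t `|` eval u
  | _ => set0
  end.
pose B j : set (Borel Y) :=
  if @unpickle (GenTree.tree (nat * nat)%type) j is Some t then eval t else set0.
have Beval t : range B (eval t).
  by exists (pickle t) => //; rewrite /B pickleK.
have evalB j : exists t, B j = eval t.
  rewrite /B; case: unpickle => [t|]; first by exists t.
  by exists (GenTree.Node 0 [::]).
have mbase ik : measurable (base ik : set (Borel Y)).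
  by apply: sub_sigma_algebra; exact: open_interior.
have ringB : setring (range B).
  have C A : range B A -> range B (~` A).
    move=> [j _ <-]; have [t ->] := evalB j.
    exact: (Beval (GenTree.Node 0 [:: t])).
  have U : setU_closed (range B).
    move=> _ _ [i _ <-] [j _ <-].
    have [t ->] := evalB i; have [u ->] := evalB j.
    exact: (Beval (GenTree.Node 0 [:: t; u])).
  split => //; first exact: (Beval (GenTree.Node 0 [::])).
  move=> A A' BA BA'; rewrite setDE -[A]setCK -setCU.
  by apply: (C); apply: (U) => //; exact: (C).
have mB j : measurable (B j).
  have [t ->] := evalB j; elim/GenTree.tree_ind: t => [ik|n s ih]; first exact: mbase.
  case: n s ih => [|n] [|t [|u [|v s]]] //=.
  - by move=> [mt _]; exact: (@measurableC _ (Borel Y)).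
  - by move=> [mt [mu _]]; exact: (@measurableU _ (Borel Y)).
  - by move=> [mt [mu _]]; exact: (@measurableU _ (Borel Y)).
exists B; split => //.
  by have := Beval (GenTree.Node 0 [:: GenTree.Node 0 [::]]); rewrite /= setC0.
apply/seteqP; split; last first.
  by apply: smallest_sub; [exact: sigma_algebra_measurable|move=> _ [j _ <-]].
apply: smallest_sub; first exact: smallest_sigma_algebra.
move=> U oU.
rewrite (_ : U = \bigcup_n (if @unpickle (nat * nat)%type n is Some ik then
    if `[< base ik `<=` U >] then base ik else set0 else set0)).
  apply: sigma_algebra_bigcup => n.
  case: unpickle => [ik|]; last exact: sigma_algebra0.
  case: ifP => _; last exact: sigma_algebra0.
  by apply: sub_sigma_algebra; exact: (Beval (GenTree.Leaf ik)).
apply/seteqP; split => [y Uy|y [n _]]; last first.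
  case: unpickle => [ik|//]; case: ifPn => // /asboolP; exact.
have /nbhs_ballP[r /= r0 yrU] : nbhs y U by exact: open_nbhs_nbhs.
(* With [a = 1 / k.+1] we have [2 * a <= r]: a dense point within [a / 2] of [y] has a ball of
   radius [a] inside the ball of radius [3 * a / 2 <= r] around [y]. *)
pose k := Num.truncn (2 / r).
have k0 : 0 < k.+1%:R^-1 :> R by rewrite invr_gt0.
have kr : k.+1%:R^-1 * 2 <= r.
  rewrite mulrC ler_pdivrMr// mulrC -ler_pdivrMr//.
  exact: ltW (truncnS_gt _).
have [x [Dx /interior_subset yx]] : D `&` (ball y (k.+1%:R^-1 / 2))^° !=set0.
  rewrite setIC; apply: denseD; last exact: open_interior.
  by exists y; apply: nbhsx_ballx; rewrite divr_gt0.
exists (pickle (f x, k)) => //; rewrite pickleK.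
rewrite (_ : `[< _ >] = true); last first.
  apply/asboolP => z /interior_subset; rewrite /= cP// => xz; apply: yrU.
  apply: (@le_ball _ _ _ (k.+1%:R^-1 / 2 + k.+1%:R^-1)).
    by move: k0 kr; set a := k.+1%:R^-1 => a0 ar; lra.
  exact: ball_triangle yx xz.
rewrite /base /= cP//.
apply: (@interiorS _ (ball y (k.+1%:R^-1 / 2))); last first.
  by apply: nbhsx_ballx; rewrite divr_gt0.
move=> z yz; rewrite [_^-1]splitr.
by apply: ball_triangle yz; exact: ball_sym.
Qed.

End countable_algebra.

Lemma Rintegral_probability_cst d (T : measurableType d) (R : realType)
    (m : probability T R) (r : R) : Rintegral m setT (fun=> r) = r.
Proof.
rewrite Rintegral_cst//= -[RHS]mulr1; congr (_ * _).
by rewrite -[RHS]/(fine 1%E) -(probability_setT m).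
Qed.

(** * Integrals against predicted states and observations *)

Section predictor_integrals.
Context (R : realType) dX dY dZ (X : measurableType dX) (Y : measurableType dY)
  (Z : measurableType dZ) (Q : probability Z R) (h : X -> Z -> Y).
Hypothesis mh : measurable_fun setT (fun p : X * Z => h p.1 p.2).

Definition kernel_prob d1 d2 (S : measurableType d1) (T : measurableType d2)
    (k : R.-pker S ~> T) (s : S) : probability T R :=
  unit_mass (@prob_kernel _ _ _ _ _ k s).

Let G (g : Y -> R) x : R := Rintegral Q setT (fun z => g (h x z)).

Let bmgh (g : Y -> R) x : bounded_measurable g -> bounded_measurable (fun z => g (h x z)).
Proof.
move=> [mg [C gC]]; split; last by exists C => z.
exact: (measurableT_comp mg (measurable_obs_at mh x)).
Qed.

Lemma bm_observation_mean (g : Y -> R) : bounded_measurable g -> bounded_measurable (G g).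
Proof.
move=> bg; have [mg [C gC]] := bg; split; last first.
  exists C => x; apply: le_trans (le_normr_Rintegral _ _) _ => //.
    by apply: bm_integrable; exact: bmgh.
  rewrite -[leRHS](Rintegral_probability_cst Q).
  apply: le_Rintegral => //.
  - by apply: integrable_norm; apply: bm_integrable; exact: bmgh.
  - by apply: bm_integrable; exact: bm_cst.
(* Measurability of kernel integrals is available for nonnegative integrands, hence the shift by
   [C]. *)
have -> : G g = fun x => fine (\int[obs_kernel Q mh x]_y (g y + C)%:E) - C.
  apply/funext => x; rewrite /obs_kernel ge0_integral_image_law//; last 2 first.
  - by apply/measurable_EFinP/measurable_funD => //; exact: measurable_cst.
  - move=> y _; rewrite lee_fin -lerBlDr sub0r.
    by have := gC y; rewrite ler_norml => /andP[].
  rewrite preimage_setT -/(Rintegral Q setT (fun z => g (h x z) + C)).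
  rewrite RintegralD//; last 2 first.
  - by apply: bm_integrable; exact: bmgh.
  - by apply: bm_integrable; exact: bm_cst.
  by rewrite Rintegral_probability_cst addrK.
apply: measurable_funB; last exact: measurable_cst.
apply: measurableT_comp => //; apply: measurable_fun_integral_kernel => //.
- exact: measurable_kernel.
- move=> y; rewrite lee_fin -lerBlDr sub0r.
  by have := gC y; rewrite ler_norml => /andP[].
- by apply/measurable_EFinP/measurable_funD => //; exact: measurable_cst.
Qed.

(** Fubini for the composition of the predictor with [obs_kernel]: the mean of [g] under the
    predicted observation is the predicted mean of its average over the noise. *)
Lemma Rintegral_next_obs (Phi : R.-pker (Path Y) ~> X) y (g : Y -> R) :
  bounded_measurable g ->
  Rintegral (kernel_prob (next_obs Q mh Phi) y) setT g =
  Rintegral (kernel_prob Phi y) setT (G g).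
Proof.
move=> bg; have [mg [C gC]] := bg.
have bG := bm_observation_mean bg.
have gC0 t : 0 <= g t + C.
  by rewrite -lerBlDr sub0r; have := gC t; rewrite ler_norml => /andP[].
have : Rintegral (kernel_prob (next_obs Q mh Phi) y) setT (fun t => g t + C) =
    Rintegral (kernel_prob Phi y) setT (fun x => G g x + C).
  have mgC : measurable_fun setT (fun t => (g t + C)%:E).
    by apply/measurable_EFinP/measurable_funD => //; exact: measurable_cst.
  apply: ge0_Rintegral_eq; rewrite [LHS]integral_kcomp//.
  apply: eq_integral => x _; rewrite [LHS]ge0_integral_image_law//; last first.
    by move=> t _; rewrite lee_fin.
  rewrite preimage_setT.
  have bgC : bounded_measurable (fun z => g (h x z) + C).
    by apply: bmD; [exact: bmgh|exact: bm_cst].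
  rewrite -[LHS]fineK; last by apply: integrable_fin_num => //; exact: bm_integrable.
  congr EFin; rewrite -/(Rintegral Q setT (fun z => g (h x z) + C)).
  rewrite RintegralD//; last 2 first.
  - by apply: bm_integrable; exact: bmgh.
  - by apply: bm_integrable; exact: bm_cst.
  by rewrite Rintegral_probability_cst.
rewrite !RintegralD//; try (by apply: bm_integrable; exact: bm_cst);
  try exact: bm_integrable.
by rewrite !Rintegral_probability_cst => /addIr.
Qed.

Lemma concentrated_gap (m : probability X R) (S : set X) (f f' : X -> R) e :
  measurable S -> m S = 1%E -> bounded_measurable f -> bounded_measurable f' -> 0 <= e ->
  (forall x, S x -> `|f x - f' x| <= e) ->
  `|Rintegral m setT f - Rintegral m setT f'| <= e.
Proof.
move=> mS mS1 bf bf' e0 ff'.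
have bB : bounded_measurable (fun x => f x - f' x) by exact: bmB.
rewrite -RintegralB//; [|exact: bm_integrable..].
apply: le_trans (le_normr_Rintegral _ _) _ => //; first exact: bm_integrable.
have bN : m.-integrable setT (EFin \o (fun x => `|f x - f' x|)).
  by apply: integrable_norm; exact: bm_integrable.
rewrite -lee_fin /Rintegral fineK; last exact: integrable_fin_num.
apply: (@le_trans _ _ (\int[m]_x cst e%:E x)%E); last first.
  by rewrite integral_cst// [X in (_ * X)%E]probability_setT mule1.
apply: ae_ge0_le_integral => //.
- by case/integrableP: bN.
- exists (~` S); split; first exact: measurableC.
    by rewrite [LHS]probability_setC// mS1 subee.
  by move=> x /= nx Sx; apply: nx => _; rewrite lee_fin ff'.
Qed.

End predictor_integrals.

(** * Borel measurability on the state space and transfer of almost sure statements *)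

Lemma measurable_continuous (R : realType) d (f : 'rV[R]_d -> R) :
  continuous f -> measurable_fun setT (f : Xsp R d -> R).
Proof.
move=> cf; apply: (measurability _ (RGenOInfty.measurableE R)).
move=> _ [_ [r ->] <-]; rewrite setTI; apply: sub_sigma_algebra.
by apply: open_comp => [x _|]; [exact: cf|rewrite set_itvoy; exact: open_gt].
Qed.

Lemma measurable_translate (R : realType) d (K : set 'rV[R]_d) (a : 'rV[R]_d) :
  compact K -> measurable (translate K a : set (Xsp R d)).
Proof.
move=> cK; suff cl : closed (translate K a).
  rewrite -[translate K a]setCK; apply: measurableC; apply: sub_sigma_algebra.
  exact: closed_openC.
apply: compact_closed; first exact: norm_hausdorff.
apply: continuous_compact => //; apply: continuous_subspaceT => x.
by apply: (@continuousD _ _ _ id (cst a) x); [exact: id|exact: cst_continuous].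
Qed.

Lemma ae_image_law d d' (T : measurableType d) (T' : measurableType d') (R : realType)
    (m : {measure set T -> \bar R}) (f : T -> T') (mf : measurable_fun setT f)
    (Pr : T' -> Prop) :
  {ae image_law m mf, forall y, Pr y} -> {ae m, forall w, Pr (f w)}.
Proof.
move=> [A [mA A0 PA]]; exists (f @^-1` A); split => //.
  by rewrite -[X in measurable X]setTI; exact: (mf measurableT A mA).
by move=> w /= nP; apply: PA.
Qed.

(** * Weak merging of the one step predictors *)

Theorem theorem2 (R : realType) (d : nat)
  (Yt Zt : completePseudoMetricType R) (hY : polish Yt) (hZ : polish Zt)
  (T : R.-pker Xsp R d ~> Xsp R d) (Q : probability (Borel Zt) R)
  (h : Xsp R d -> Borel Zt -> Borel Yt)
  (hmeas : measurable_fun setT (fun p : Xsp R d * Borel Zt => h p.1 p.2))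
  (mu nu : probability (Xsp R d) R) (munu : abs_cont mu nu)
  (dO : measure_display) (O : measurableType dO) (P : probability O R)
  (Xs : nat -> O -> Xsp R d) (Zs : nat -> O -> Borel Zt)
  (real_mu : hmm_realization T Q mu P Xs Zs)
  (Phimu Phinu : nat -> R.-pker (Path (Borel Yt)) ~> Xsp R d)
  (pred_mu : is_predictor T Q h mu Phimu)
  (pred_nu : is_predictor T Q h nu Phinu)
  (K : set 'rV[R]_d) (Kcpt : compact K)
  (Kpred : locally_predictable T Q h mu P Xs Zs K)
  (Kobs : locally_observable Q h K) :
  {ae P, forall w, forall f : 'rV[R]_d -> R,
     continuous f -> (exists M : R, forall x, `|f x| <= M) ->
     (fun n : nat =>
        `| Rintegral (Phimu n (obs h Xs Zs w : Path (Borel Yt))) setT f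
         - Rintegral (Phinu n (obs h Xs Zs w : Path (Borel Yt))) setT f |)
       @ \oo --> (0 : R)}.
Proof.
have real_nu := hmm_law_realization T Q nu.
have real_mu' := hmm_law_realization T Q mu.
pose M : probability (Path (Borel Yt)) R := image_law P (obs_measurable hmeas real_mu).
pose N : probability (Path (Borel Yt)) R :=
  image_law (hmm_law T Q nu) (obs_measurable hmeas real_nu).
(* The given realization has the law of the constructed one started from [mu], and for constructed
   realizations absolute continuity is known. *)
have MN A : measurable A -> N A = 0%E -> M A = 0%E.
  move=> mA; have mA' : measurable (@obs_path _ _ _ _ _ _ h @^-1` A).
    by rewrite -[X in measurable X]setTI; exact: (measurable_obs_path hmeas).
  have ME : M A = hmm_law T Q mu (joint_path (fun n w => w.1 n) (fun n w => w.2 n) @^-1`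
      (@obs_path _ _ _ _ _ _ h @^-1` A)).
    exact: (realization_law_unique real_mu real_mu' mA').
  move=> NA; rewrite ME; apply: (hmm_law_abs_cont munu) => //.
  by rewrite -[X in measurable X]setTI; apply: (obs_measurable hmeas real_mu').
have [B [mB ringB BT BE]] := polish_countable_algebra hY.
pose p n := next_obs Q hmeas (Phimu n); pose q n := next_obs Q hmeas (Phinu n).
have dp n := next_obs_depends Q hmeas (pred_mu.1 n).
have dq n := next_obs_depends Q hmeas (pred_nu.1 n).
have stepM n := @next_obs_law _ _ _ _ _ _ _ _ _ _ hmeas _ _ _ _ _ _ real_mu _ pred_mu n.
have stepN n := @next_obs_law _ _ _ _ _ _ _ _ _ _ hmeas _ _ _ _ _ _ real_nu _ pred_nu n.
have := @one_step_merging _ _ _ M N p q dp dq stepM stepN MN B mB.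
move=> /ae_image_law merge.
have [a [ma [da aP]]] := Kpred.
have /ae_foralln amu := aP mu Phimu (fun _ _ => id) pred_mu.
have /ae_foralln anu := aP nu Phinu munu pred_nu.
(* None of the three almost sure properties mentions [f], so the null set is common to all test
   functions. *)
apply: filterS3 merge amu anu => w; set y := obs h Xs Zs w.
move=> gapy Kmu Knu f cf [C fC]; apply/cvgrPdist_le => e e0.
have bf : bounded_measurable (f : Xsp R d -> R).
  by split; [exact: measurable_continuous|exists C].
have e3 : 0 < e / 3 by rewrite divr_gt0.
(* On the fixed path the centers [a n y] form a deterministic sequence, as local observability
   requires. *)
have [g [mg [[C' gC'] fg]]] := Kobs f cf (ex_intro _ C fC) (fun n => a n y) _ e3.
have C'0 : 0 <= C' by rewrite (le_trans _ (gC' 0%N point)).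
have bg n : bounded_measurable (g n) by split => //; exists C'.
(* Gives [2 * C' * e' <= e / 3]; adding [1] covers [C' = 0]. The approximations under the two
   predictors supply the other two thirds. *)
pose e' := e / (6 * (C' + 1)).
have e'0 : 0 < e' by rewrite divr_gt0// mulr_gt0// ltr_wpDl.
have [m mgap] := gapy e' e'0; near=> n.
have mn : (m <= n)%N by near: n; exact: nbhs_infty_ge.
have mK := measurable_translate (a n y) Kcpt.
have bgG := bm_observation_mean Q hmeas (bg n).
have gmu : `|Rintegral (kernel_prob (Phimu n) y) setT f -
    Rintegral (kernel_prob (p n) y) setT (g n)| <= e / 3.
  rewrite Rintegral_next_obs//; apply: (concentrated_gap (m := kernel_prob (Phimu n) y) mK (Kmu n)) => //.
    exact: ltW.
  exact: fg.
have gnu : `|Rintegral (kernel_prob (Phinu n) y) setT f -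
    Rintegral (kernel_prob (q n) y) setT (g n)| <= e / 3.
  rewrite Rintegral_next_obs//; apply: (concentrated_gap (m := kernel_prob (Phinu n) y) mK (Knu n)) => //.
    exact: ltW.
  exact: fg.
have gpq : `|Rintegral (kernel_prob (p n) y) setT (g n) -
    Rintegral (kernel_prob (q n) y) setT (g n)| <= 2 * C' * e'.
  apply: gap_Rintegral => //; apply: gap_on_algebra ringB BT BE _.
  by move=> _ [j _ <-]; exact: mgap.
have e'E : 2 * C' * e' <= e / 3.
  have C'1 : 0 < C' + 1 by rewrite ltr_wpDl.
  rewrite /e' mulrA ler_pdivrMr ?mulr_gt0//; nra.
rewrite sub0r normrN normr_id.
move: gmu gnu gpq; rewrite !ler_norml => /andP[? ?] /andP[? ?] /andP[? ?].
rewrite -/(Rintegral (kernel_prob (Phimu n) y) setT f).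
rewrite -/(Rintegral (kernel_prob (Phinu n) y) setT f).
by apply/andP; split; lra.
Unshelve. all: by end_near. Qed.
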